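(* Let $\kappa,\tau,\delta$ be infinite cardinals. The following are equivalent: (1) $\tau\leq\mathbf{d}(\kappa)$ and $\delta\geq\mathbf{b}_\kappa(\tau)$. (2) There exist a Banach space $X$ and a (closed) subspace $Y$ of $X$ such that $CG(X)=\kappa$, $CG(Y)=\tau$ and $dens(Y)=\delta$.
   Context: For a topological space $Z$, the index of compact generation $CG(Z)$ is the least infinite cardinal $\kappa$ such that there exists a family $\{K_\lambda:\lambda<\kappa\}$ of compact subsets of $Z$ whose union is dense in $Z$. For a Banach space $X$, $CG(X)$ is always computed with respect to the weak topology of $X$. $dens(Y)$ denotes the density character of $Y$ (the least cardinality of a norm-dense subset). A cardinal $\kappa$ is regarded as a discrete topological space of cardinality $\kappa$, and $\kappa^\omega$ is the space of sequences of elements of $\kappa$ with the product topology. The cardinal $\mathbf{d}(\kappa)$ is the least cardinal $\lambda$ such that $\kappa^\omega$ is the union of $\lambda$ many compact subsets. For a cardinal $\tau\leq\mathbf{d}(\kappa)$, $\mathbf{b}_\kappa(\tau)$ is the least cardinal $\lambda$ for which there exists a set $A\subset\kappa^\omega$ of cardinality $\lambda$ such that $A$ is not contained in any union of less than $\tau$ many compact subsets of $\kappa^\omega$. *)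

(* Defs.v *)
From HB Require Import structures.
From mathcomp Require Import all_boot all_order all_algebra.
From mathcomp Require Import all_classical all_reals topology normedtype.

Set Implicit Arguments.
Unset Strict Implicit.
Unset Printing Implicit Defensive.

Import Order.TTheory GRing.Theory Num.Theory.
Import numFieldNormedType.Exports.

Local Open Scope classical_set_scope.
Local Open Scope card_scope.
Local Open Scope ring_scope.

(* A cardinal is represented by any type of that cardinality, and cardinals are
   compared through [#<=]. A least cardinal is thus unique up to equipotence;
   classically, one exists as soon as some type satisfies [P]. Below, [is_CG Z L]
   reads "CG(Z) = |L|", and likewise for [is_dens], [is_d] and [is_b]. *)
Definition least_card (P : Type -> Prop) (L : Type) : Prop :=
  P L /\ forall L' : Type, P L' -> [set: L] #<= [set: L'].

Definition is_CG (Z : topologicalType) : Type -> Prop :=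
  least_card (fun L => infinite_set [set: L] /\
    exists K : L -> set Z, (forall l, compact (K l)) /\ dense (\bigcup_l K l)).

Definition is_dens (Z : topologicalType) : Type -> Prop :=
  least_card (fun L => exists A : set Z, dense A /\ A #= [set: L]).

(* The space of sequences in the discrete space [K]; [{classic K}] only equips
   the type [K] with a choice structure. *)
Definition seq_space (K : Type) : topologicalType :=
  prod_topology (fun _ : nat => discrete_topology {classic K}).

Definition is_d (K : Type) : Type -> Prop :=
  least_card (fun L => exists C : L -> set (seq_space K),
    (forall l, compact (C l)) /\ \bigcup_l C l = [set: seq_space K]).

(* The hypotheses on [I] say that |I| < |T|. *)
Definition is_b (K T : Type) : Type -> Prop :=
  least_card (fun L => exists A : set (seq_space K), A #= [set: L] /\
    forall (I : Type) (C : I -> set (seq_space K)),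
      [set: I] #<= [set: T] -> ~ ([set: T] #<= [set: I]) ->
      (forall i, compact (C i)) -> ~ (A `<=` \bigcup_i C i)).

Section weak_topology.
Variables (R : realType) (X : normedModType R).

Definition dual : Type := {f : {linear X -> R^o} | continuous f}.

(* [X] with the coarsest topology making all [f : dual] continuous. *)
Definition weak : Type := X.

HB.instance Definition _ := Topological.copy weak
  (sup_topology (fun f : dual =>
     Topological.class (initial_topology (sval f : X -> R^o)))).

End weak_topology.

Section closed_subspace.
Variables (R : realType) (X : completeNormedModType R).

Record closed_subspace := ClosedSubspace {
  csub_set :> set X;
  csub0 : csub_set 0;
  csubP : forall (a : R) (x y : X),
    csub_set x -> csub_set y -> csub_set (a *: x + y);
  csub_closed : closed csub_set }.

Variable Y : closed_subspace.

Definition csub_pred : {pred X} := [pred x | x \in csub_set Y].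

(* [Y] as a Banach space in its own right, with the operations and the norm of
   [X]; [weak (csub_type Y)] is thus given by the functionals on [Y] itself. *)
Definition csub_type : Type := {x : X | csub_pred x}.

HB.instance Definition _ := [isSub for (@sval X csub_pred) : csub_type -> X].
HB.instance Definition _ := [Choice of csub_type by <:].

Lemma csub_submod : submod_closed csub_pred.
Proof.
split; first by apply/mem_set; exact: csub0.
by move=> a x y /set_mem Yx /set_mem Yy; apply/mem_set; exact: csubP.
Qed.

HB.instance Definition _ := GRing.SubChoice_isSubLmodule.Build
  R X csub_pred csub_type csub_submod.

Let csub_norm (y : csub_type) : R := `|val y|.

Let csub_normD x y : csub_norm (x + y) <= csub_norm x + csub_norm y.
Proof. by rewrite /csub_norm raddfD; exact: ler_normD. Qed.

Let csub_normZ (a : R) x : csub_norm (a *: x) = `|a| * csub_norm x.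
Proof. by rewrite /csub_norm linearZ /= normrZ. Qed.

Let csub_norm_eq0 x : csub_norm x = 0 -> x = 0.
Proof. by move=> /normr0_eq0 x0; apply: val_inj; rewrite x0 raddf0. Qed.

HB.instance Definition _ := Lmodule_isNormed.Build R csub_type
  csub_normD csub_normZ csub_norm_eq0.

Lemma csub_complete (F : set_system csub_type) :
  ProperFilter F -> cauchy F -> cvg F.
Proof.
move=> FF /cauchy_ballP Fc.
have vFF : ProperFilter (val @ F) by exact: fmap_proper_filter.
have vFc : cauchy (val @ F).
  apply/cauchy_ballP => e e0.
  have [[A B] [/= FA FB] AB] := Fc e e0.
  exists (val @` A, val @` B).
    by split; [apply: filterS FA|apply: filterS FB] => x ?; exists x.
  move=> [_ _] [[x Ax <-] [y By <-]].
  by have := AB (x, y) (conj Ax By); rewrite /= -!ball_normE.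
have /cvg_ex[l Fl] := @cauchy_cvg X _ vFF vFc.
have Yl : csub_set Y l.
  apply: (closed_cvg (u_ := val) (F := F)) Fl; first exact: csub_closed.
  by apply: nearW => x; exact/set_mem/(valP x).
apply/cvg_ex; exists (exist _ l (mem_set Yl) : csub_type).
by apply/cvgrPdist_lt => e e0; move/cvgrPdist_lt : Fl => /(_ e e0).
Qed.

HB.instance Definition _ := Uniform_isComplete.Build csub_type csub_complete.

End closed_subspace.

(* Main.v *)
Require Import Defs.
From HB Require Import structures.
From mathcomp Require Import all_boot all_order all_algebra finmap.
From mathcomp Require Import all_classical all_reals topology normedtype.
From mathcomp Require Import ring lra.

(** In the direction from a Banach space [X] with a subspace [Y] to the
    inequalities, the union of [kappa] weakly compact sets [K l] may be assumed
    to be norm dense in [X] ([CG_norm_dense]). A point of [Y] is then coded by a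
    sequence in [kappa^omega], whose [n]-th term selects a [K l] at distance at
    most [1/(n+1)]. A compact set of sequences is a set with finitely many
    values at each [n], and by Grothendieck's criterion ([approx_compact]) the
    points of [Y] coded by it lie in a weakly compact set. Thus coverings of
    codes by compact sets yield coverings of [Y], or of a dense subset of [Y],
    by weakly compact sets: this gives both inequalities
    ([CG_subspace_bounds]). The criterion and the passage from weak to norm
    density rest on the Hahn-Banach theorem ([hahn_banach]).

    Conversely, let [A] be a subset of [kappa^omega] with at most [delta] points
    that is not covered by fewer than [tau] compact sets. Choose [phi] and [grp]
    on [delta] such that [(phi, grp)] takes all values in the product of [A] and
    [tau]. For a family of sets closed under subsets, consider the space of
    functions normed by the supremum of the [l_1]-norms on the members of the
    family. A set of unit vectors that meets each member at most once is weakly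
    null ([disjoint_family_compact]), whereas the unit vectors of a member form
    an [l_1]-basis, of which a weakly compact set accounts for finitely many
    ([weak_compact_coords]). Take a copy of [delta] for every level [n], the
    members at this level being the sets on which both the [n]-th term of [phi]
    and [grp] are injective, and a copy of [l_1(kappa)]. Let [X] be the space
    obtained and [Y] the closed span of the vectors [sum_n 2^-n e_(n, g)].
    Fixing the level and the [n]-th term of [phi] gives [kappa] weakly null sets
    that generate [X]; fixing [grp] gives [tau] weakly null sets that generate
    [Y], and the density of [Y] is [delta]. The [l_1(kappa)] part requires
    [kappa] sets. Finally, fewer than [tau] sets do not suffice for [Y]
    ([CG_Y_ge]): each class of [grp] contains a copy of [A], which forces one of
    the sets to contain, for a suitable level [n], points of the class with
    infinitely many values of the [n]-th term; infinitely many classes must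
    share the same set and level, and a selection of points in them is an
    infinite member of the family.

    The cardinal arithmetic consists of the existence of least cardinals
    ([exists_least_card]) and of the equality of an infinite cardinal with its
    square ([card_sqr_le]). *)

Set Implicit Arguments.
Unset Strict Implicit.
Unset Printing Implicit Defensive.

Import Order.TTheory GRing.Theory Num.Theory.
Import numFieldNormedType.Exports.

Local Open Scope classical_set_scope.
Local Open Scope card_scope.
Local Open Scope ring_scope.

(** * Cardinal arithmetic *)

Lemma card_leTP (A B : Type) :
  [set: A] #<= [set: B] <-> exists f : A -> B, injective f.
Proof.
split=> [/card_leP[f]|[f f_inj]].
  exists (fun x => set_val (f (SigSub (mem_set (I : [set: A] x))))) => x y.
  by move=> /val_inj/(@inj _ _ _ f) => /(_ (in_setT _) (in_setT _)) [].
have /injfunPex[g] : exists2 g : A -> B, set_fun setT setT g & set_inj setT g.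
  by exists f => // x y _ _ /f_inj.
exact: inj_card_le.
Qed.

(** Consider a set of points of the product on which every projection is
    injective, and which is maximal with this property. Some projection maps it
    onto [S i]: otherwise a point with all its coordinates outside the
    projections could be added. The inverse of that projection, followed by the
    others, embeds [S i] into every [S j]. *)
Lemma exists_min_card (I : Type) (i0 : I) (S : I -> Type) :
  exists i, forall j, [set: S i] #<= [set: S j].
Proof.
pose P (G : set (forall i, S i)) := forall i, set_inj G (fun x => x i).
have [F FP totF|G [PG maxG]] := @Zorn_bigcup _ P.
  move=> i x y /set_mem[A FA Ax] /set_mem[B FB By] xy.
  have [AB|BA] := totF _ _ FA FB.
    by apply: (FP _ FB i) => //; rewrite inE; [exact: AB|].
  by apply: (FP _ FA i) => //; rewrite inE; [|exact: BA].
have [i iP] : exists i, forall y : S i, exists2 x, G x & x i = y.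
  apply: contrapT => /forallNP noi.
  have yP i : {y : S i | forall x, G x -> x i <> y}.
    apply: cid; have /existsNP[y yN] := noi i.
    by exists y => x Gx xy; apply: yN; exists x.
  pose y i := sval (yP i); have yN i := svalP (yP i).
  apply: (maxG (G `|` [set y])).
    split=> [|/(_ y (or_intror erefl)) /(yN i0)]; first exact: subsetUl.
    by apply.
  move=> i x z /set_mem[Gx|->] /set_mem[Gz|->] //.
  - by apply: (PG i); rewrite inE.
  - by move=> xz; case: (yN i _ Gx).
  - by move=> zx; case: (yN i _ Gz).
exists i => j; apply/card_leTP.
pose x (y : S i) := sval (cid2 (iP y)).
have Gx y : G (x y) by rewrite /x; case: cid2.
have xi y : x y i = y by rewrite /x; case: cid2.
exists (fun y => x y j) => y z yz.
by rewrite -(xi y) -(xi z); congr (_ i); apply: (PG j); rewrite ?inE.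
Qed.

Lemma card_le_total (A B : Type) :
  [set: A] #<= [set: B] \/ [set: B] #<= [set: A].
Proof.
have [[|] bP] := exists_min_card true (fun b : bool => if b then A else B).
  by left; exact: (bP false).
by right; exact: (bP true).
Qed.

(** Among the subsets of [L0] that satisfy [P], one has least cardinality; any
    type that satisfies [P] either is equipotent with such a subset or has at
    least the cardinality of [L0]. *)
Lemma exists_least_card (P : Type -> Prop) (L0 : Type) :
  (forall A B : Type, [set: A] #= [set: B] -> P A -> P B) -> P L0 ->
  exists L, least_card P L.
Proof.
move=> Peq PL0.
pose S (s : {S : set L0 | P S}) : Type := sval s.
have PT : P [set: L0] by apply: (Peq L0) => //; rewrite card_eq_sym card_setT.
have [s sP] := exists_min_card (exist (fun S : set L0 => P S) _ PT) S.
exists (S s); split; first exact: svalP s.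
move=> L' PL'; have [/card_leTP[f f_inj]|L0L'] := card_le_total L' L0;
  last first.
  apply: card_le_trans L0L'; rewrite (card_le_eql (card_setT _)).
  exact: card_leT.
have fL' : [set: L'] #= [set: range f].
  rewrite card_eq_sym (card_eql (card_setT _)); apply: inj_card_eq.
  by move=> x y _ _ /f_inj.
apply: card_le_trans (sP (exist _ (range f) (Peq _ _ fL' PL'))) _ => /=.
by have /card_eqPle[] := fL'.
Qed.

Lemma infinite_natP (K : Type) :
  infinite_set [set: K] <-> exists e : nat -> K, injective e.
Proof. by rewrite infiniteP card_leTP. Qed.

(** Zorn's lemma above a given element of [P]: the sets [A] such that
    [G0 `|` A] satisfies [P] contain [set0], which takes care of the empty
    chain. *)
Lemma Zorn_bigcup_above (T : Type) (P : set (set T)) (G0 : set T) :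
  P G0 ->
  (forall F : set (set T), F !=set0 -> F `<=` P -> total_on F subset ->
    P (\bigcup_(X in F) X)) ->
  exists G, [/\ G0 `<=` G, P G & forall H, G `<=` H -> P H -> H `<=` G].
Proof.
move=> PG0 PU.
have [F FP totF|A [PA maxA]] := @Zorn_bigcup _ (fun G => P (G0 `|` G)).
  have [->|/set0P[G FG]] := eqVneq F set0; first by rewrite bigcup_set0 setU0.
  rewrite (_ : _ `|` _ = \bigcup_(H in [set G0 `|` G | G in F]) H).
    apply: PU => [|_ [H FH <-]|].
    - by exists (G0 `|` G), G.
    - exact: FP.
    - move=> _ _ [H FH <-] [H' FH' <-].
      by have [HH'|H'H] := totF _ _ FH FH'; [left|right]; exact: setUS.
  apply/seteqP; split=> [u [G0u|[H FH Hu]]|u [_ [H FH <-] [G0u|Hu]]].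
  - by exists (G0 `|` G); [exists G|left].
  - by exists (G0 `|` H); [exists H|right].
  - by left.
  - by right; exists H.
exists (G0 `|` A); split=> // H sub PH; apply: contrapT => nsub.
apply: (maxA H); last first.
  by rewrite (_ : _ `|` _ = H)//; apply/setUidPr => x ?; apply: sub; left.
split=> [x Ax|HA]; first by apply: sub; right.
by apply: nsub => x /HA; right.
Qed.


Section square.
Variable K : Type.

Let dom (G : set (K * K * K)) : set K := [set x | exists z, G (x, x, z)].

(** The injections of [D * D] into [D], for [D] a subset of [K], as graphs. *)
Let pairing_graph (G : set (K * K * K)) := [/\
  forall x y z, G (x, y, z) -> [/\ dom G x, dom G y & dom G z],
  forall x y, dom G x -> dom G y -> exists z, G (x, y, z),
  forall x y z z', G (x, y, z) -> G (x, y, z') -> z = z' &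
  forall x y x' y' z, G (x, y, z) -> G (x', y', z) -> x = x' /\ y = y'].

Let pairing_graph_bigcup (F : set (set (K * K * K))) :
  F `<=` pairing_graph -> total_on F subset ->
    pairing_graph (\bigcup_(G in F) G).
Proof.
move=> FP totF.
have domU G x : F G -> dom G x -> dom (\bigcup_(G in F) G) x.
  by move=> FG [z Gz]; exists z, G.
have common A B : F A -> F B -> exists2 C, F C & A `<=` C /\ B `<=` C.
  move=> FA FB; have [AB|BA] := totF _ _ FA FB.
    by exists B => //; split.
  by exists A => //; split.
split=> [x y z [G FG Gxyz]|x y [z [A FA Ax]] [z' [B FB By]]
        |x y z z' [A FA Ax] [B FB By]|x y x' y' z [A FA Ax] [B FB By]].
- have [G1 _ _ _] := FP _ FG; have [Gx Gy Gz] := G1 _ _ _ Gxyz.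
  by split; apply: domU FG _.
- have [C FC [AC BC]] := common _ _ FA FB.
  have [_ /(_ x y) + _ _] := FP _ FC.
  case=> [||t Ct]; [by exists z; exact: AC|by exists z'; exact: BC|].
  by exists t, C.
- have [C FC [AC BC]] := common _ _ FA FB.
  by have [_ _ + _] := FP _ FC; move/(_ _ _ _ _ (AC _ Ax) (BC _ By)).
- have [C FC [AC BC]] := common _ _ FA FB.
  by have [_ _ _] := FP _ FC; move/(_ _ _ _ _ _ (AC _ Ax) (BC _ By)).
Qed.

Let pairing_graph_fun G : pairing_graph G ->
  {f : dom G -> dom G -> dom G |
    (forall x y, G (val x, val y, val (f x y))) /\
    forall x y x' y', f x y = f x' y' -> x = x' /\ y = y'}.
Proof.
move=> [G1 G2 G3 G4].
have fP (xy : dom G * dom G) : exists z : dom G, G (val xy.1, val xy.2, val z).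
  case: xy => -[x xG] [y yG] /=.
  have [z Gz] := G2 x y (set_mem xG) (set_mem yG).
  by have [_ _ zG] := G1 _ _ _ Gz; exists (SigSub (mem_set zG)).
exists (fun x y => sval (cid (fP (x, y)))); split=> [x y|x y x' y' e].
  by case: (cid _).
have := svalP (cid (fP (x, y))); rewrite /= e.
have /= Gxy' := svalP (cid (fP (x', y'))).
by move=> Gxy; have [] := G4 _ _ _ _ _ Gxy Gxy'; split; exact: val_inj.
Qed.

(** A maximal pairing of a subset [D] of [K], chosen to extend a pairing of a
    countable subset, has [D] equipotent with [K]. Otherwise the complement of
    [D] contains a copy [h D] of [D], and the pairing extends to the union of
    [D] and [h D], the new pairs being sent into [h D]: their codes in [D]
    consist of two flags, that tell the copies apart, and two points of [D]. *)
Lemma card_sqr_le : infinite_set [set: K] -> [set: K * K] #<= [set: K].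
Proof.
move=> /infinite_natP[e e_inj].
pose code (m n : nat) : nat := choice.pickle (m, n).
pose G0 : set (K * K * K) :=
  [set u | exists m n, u = (e m, e n, e (code m n))].
have G0dom x : dom G0 x <-> exists n, x = e n.
  split=> [[z [m [n [-> _ _]]]]|[n ->]]; first by exists m.
  by exists (e (code n n)), n, n.
have PG0 : pairing_graph G0.
  split=> [x y z [m [n [-> -> ->]]]|x y /G0dom[m ->] /G0dom[n ->]
          |x y z z' [m [n [-> -> ->]]]|x y x' y' z [m [n [-> -> ->]]]].
  - by split; apply/G0dom; eexists.
  - by exists (e (code m n)), m, n.
  - by move=> [m' [n' [/e_inj -> /e_inj -> ->]]].
  - move=> [m' [n' [-> -> /e_inj]]].
    by move=> /(pcan_inj (@choice.pickleK (nat * nat)%type))[-> ->].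
have [G [G0G PG Gmax]] :=
  Zorn_bigcup_above PG0 (fun F _ => @pairing_graph_bigcup F).
have [f [Gf f_inj]] := pairing_graph_fun PG.
have eG n : e n \in dom G.
  rewrite inE; have [z G0z] : dom G0 (e n) by apply/G0dom; exists n.
  by exists z; exact: G0G.
pose s (b : bool) : dom G := SigSub (eG b).
have s_inj : injective s by move=> [] [] // [/e_inj].
have [CS|] := card_le_total (~` dom G) (dom G).
  move/card_leTP : CS => [c c_inj].
  pose g (x : K) : dom G := if pselect (dom G x) is left xG
    then f (s true) (SigSub (mem_set xG))
    else if pselect ((~` dom G) x) is left xN
    then f (s false) (c (SigSub (mem_set xN)))
    else s true.
  have g_inj : injective g.
    move=> x y; rewrite /g.
    case: (pselect (dom G x)) => xG; case: (pselect (dom G y)) => yG.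
    - by move=> /f_inj[_ []].
    - by case: pselect => // yN /f_inj[/s_inj].
    - by case: pselect => // xN /f_inj[/s_inj].
    - case: pselect => // xN; case: pselect => // yN /f_inj[_ /c_inj].
      by case.
  apply/card_leTP; exists (fun u => val (f (g u.1) (g u.2))) => -[x y] [x' y'].
  by move=> /val_inj/f_inj[/g_inj /= -> /g_inj /= ->].
move=> /card_leTP[h h_inj]; exfalso.
have sval_inj (C : set K) (x y : C) : sval x = sval y -> x = y.
  exact: (@val_inj _ _ C).
pose u (b : bool) (x : dom G) : K := if b then sval (h x) else sval x.
have uN x : ~ dom G (sval (h x)) by have /set_mem := valP (h x).
have u_inj b b' x x' : u b x = u b' x' -> b = b' /\ x = x'.
  case: b b' => -[] /=.
  - by move=> /sval_inj/h_inj.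
  - by move=> E; case: (uN x); rewrite E; exact: set_mem (valP x').
  - by move=> E; case: (uN x'); rewrite -E; exact: set_mem (valP x).
  - by move=> /sval_inj.
pose H : set (K * K * K) := [set w | exists b b' x y, b || b' /\
  w = (u b x, u b' y, sval (h (f (f (f (s b) (s b')) x) y)))].
have domGH x : dom (G `|` H) x <-> exists b y, x = u b y.
  split=> [[z [Gz|[b [b' [y [y' [_ [-> _ _]]]]]]]]|[[|] [y ->]]].
  - have xG : dom G x by exists z.
    by exists false, (SigSub (mem_set xG)).
  - by exists b, y.
  - by eexists; right; exists true, true, y, y.
  - by have [z Gz] := set_mem (valP y); exists z; left.
have [G1 G2 G3 G4] := PG.
have Gu b b' x y z : G (u b x, u b' y, z) -> ~~ (b || b').
  by case: b b' => -[] // /G1[] //= ? ? _; exfalso; apply: uN; eassumption.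
suff PGH : pairing_graph (G `|` H).
  have HG : H `<=` G by move=> v Hv; apply: Gmax PGH _ _; [left|right].
  have /HG/Gu// : H (u true (s true), u true (s true),
    sval (h (f (f (f (s true) (s true)) (s true)) (s true)))).
  by exists true, true, (s true), (s true).
split=> [x y z [Gz|[b [b' [x' [y' [_ [-> -> ->]]]]]]]
        |x y /domGH[b [x' ->]] /domGH[b' [y' ->]]
        |x y z z'|x y x' y' z].
- have [[x' Gx] [y' Gy] [z' Gz']] := G1 _ _ _ Gz.
  by split; [exists x'|exists y'|exists z']; left.
- split; apply/domGH; [by exists b, x'|by exists b', y'|].
  by exists true; eexists; reflexivity.
- case bb' : (b || b').
    by eexists; right; exists b, b', x', y'; split=> //; reflexivity.
  move: bb'; case: b b' => -[] // _; exists (val (f x' y')); left; exact: Gf.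
- move=> [Gz|[b [b' [p [q [bb' [-> -> ->]]]]]]].
    move=> [|[b [b' [p [q [bb' [xE yE ->]]]]]]]; first exact: G3 Gz.
    by move: Gz; rewrite xE yE => /Gu; rewrite bb'.
  move=> [/Gu|[c [c' [p' [q' [cc' [/u_inj[-> ->] /u_inj[-> ->] ->]]]]]]] //.
  by rewrite bb'.
- move=> [Gz|[b [b' [p [q [bb' [-> -> ->]]]]]]].
    move=> [|[b [b' [p [q [bb' [xE yE zE]]]]]]]; first exact: G4 Gz.
    have [_ _] := G1 _ _ _ Gz; rewrite zE => /uN //.
  move=> [/G1[_ _ /uN//]|[c [c' [p' [q' [cc' [-> -> ]]]]]]].
  by move=> /sval_inj/h_inj/f_inj[/f_inj[/f_inj[/s_inj -> /s_inj ->] ->] ->].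
Qed.

End square.

Lemma card_prod_le (K A B : Type) : infinite_set [set: K] ->
  [set: A] #<= [set: K] -> [set: B] #<= [set: K] -> [set: A * B] #<= [set: K].
Proof.
move=> /card_sqr_le/card_leTP[p pI] /card_leTP[f fI] /card_leTP[g gI].
apply/card_leTP; exists (fun u => p (f u.1, g u.2)) => -[a b] [a' b'].
by move=> /pI[/fI -> /gI ->].
Qed.

Lemma card_seq_le (K A : Type) : infinite_set [set: K] ->
  [set: A] #<= [set: K] -> [set: seq A] #<= [set: K].
Proof.
move=> Kinf /card_leTP[f fI]; have [k0 _] := infinite_setN0 Kinf.
have /card_leTP[p pI] := card_sqr_le Kinf.
apply: (@card_le_trans _ (nat * K)%type _ setT); last first.
  by apply: card_prod_le => //; apply/infiniteP.
apply/card_leTP.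
exists (fun s => (size s, foldr (fun x k => p (f x, k)) k0 s)).
elim=> [|x s IH] [|y t] //= [st /pI[/fI -> e]]; congr (_ :: _).
by apply: IH; rewrite st e.
Qed.

Lemma card_le_countable_cover (K I A : Type) (T : I -> set A) :
  infinite_set [set: K] -> [set: I] #<= [set: K] ->
  (forall i, countable (T i)) -> (forall a, exists i, T i a) ->
  [set: A] #<= [set: K].
Proof.
move=> Kinf IK /(_ _)/countable_injP/cid-/all_sig[n nI].
move=> /(_ _)/cid-/all_sig[i Ti].
apply: (@card_le_trans _ (I * nat)%type _ setT).
  apply/card_leTP; exists (fun a => (i a, n (i a) a)) => a b [ab].
  by rewrite ab => /nI; apply; rewrite inE // -ab.
by apply: card_prod_le => //; apply/infiniteP.
Qed.

(** * Hahn-Banach theorem *)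

Section functionals.
Variables (R : realType) (X : normedModType R).
Implicit Types (x y : X) (f : dual X).

Lemma dual_bound f : exists2 M : R, 0 < M & forall x, `|sval f x| <= M * `|x|.
Proof.
have /linear_bounded_continuous/linear_boundedP := svalP f.
by move=> /pinfty_ex_gt0[M M0 fM]; exists M.
Qed.

Lemma bounded_dual (g : {linear X -> R^o}) (M : R) :
  (forall x, `|g x| <= M * `|x|) -> exists f, forall x, sval f x = g x.
Proof.
move=> gM; suff cg : continuous g by exists (exist _ g cg).
apply/linear_bounded_continuous/bounded_funP => r;
  exists (Num.max M 0 * r) => x xr.
apply: (le_trans (gM x)).
apply: (le_trans (ler_wpM2r _ _) (ler_wpM2l _ xr)) => //.
  by rewrite le_max lexx.
by rewrite le_max lexx orbT.
Qed.

(** A linear relation below [M * `|x|] is the graph of a functional defined on a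
    subspace: the values related to [0] are at most [0], and so are their
    opposites. *)
Definition dominated_graph (M : R) (G : set (X * R)) : Prop := [/\ G (0, 0),
  forall (a : R) x r y s, G (x, r) -> G (y, s) -> G (a *: x + y, a * r + s) &
  forall x r, G (x, r) -> r <= M * `|x|].

Lemma dominated_graph_norm M G x r :
  dominated_graph M G -> G (x, r) -> `|r| <= M * `|x|.
Proof.
move=> [G0 GD GM] Gx; rewrite ler_norml (GM _ _ Gx) andbT.
have := GM _ _ (GD (-1) _ _ _ _ Gx G0).
by rewrite !addr0 scaleN1r normrN mulN1r => H; rewrite -lerN2 opprK.
Qed.

Lemma dominated_graph_bigcup M (F : set (set (X * R))) : F !=set0 ->
  F `<=` dominated_graph M -> total_on F subset ->
  dominated_graph M (\bigcup_(G in F) G).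
Proof.
move=> [A FA] FM totF; split.
- by exists A => //; have [] := FM _ FA.
- move=> a x r y s [B FB Bx] [C FC Cy].
  have [BC|CB] := totF _ _ FB FC.
    by exists C => //; have [_ + _] := FM _ FC; apply => //; exact: BC.
  by exists B => //; have [_ + _] := FM _ FB; apply => //; exact: CB.
- by move=> x r [B FB]; have [_ _ +] := FM _ FB; apply.
Qed.

(** The one-dimensional extension: a value [c] at [x0] keeps the graph dominated
    when it lies between all [r - M * `|x - x0|] and all [M * `|x + x0| - r];
    the former are below the latter by the triangle inequality. *)
Lemma dominated_graph_extend (M : R) G x0 : 0 <= M -> dominated_graph M G ->
  exists2 c,
    G `<=` [set u | exists x r t, G (x, r) /\ u = (x + t *: x0, r + t * c)] &
    dominated_graph M
      [set u | exists x r t, G (x, r) /\ u = (x + t *: x0, r + t * c)].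
Proof.
move=> M0 [G0 GD GM].
pose L : set R := [set l | exists x r, G (x, r) /\ l = r - M * `|x - x0|].
have LB x r x' r' : G (x, r) -> G (x', r') ->
    r' - M * `|x' - x0| <= M * `|x + x0| - r.
  move=> Gx Gx'; have := GM _ _ (GD 1 _ _ _ _ Gx Gx'); rewrite scale1r mul1r.
  have : M * `|x + x'| <= M * `|x + x0| + M * `|x' - x0|.
    rewrite -mulrDr ler_wpM2l // (le_trans _ (ler_normD _ _))//.
    by rewrite addrACA subrr addr0.
  lra.
have L0 : has_sup L.
  split; first by exists (0 - M * `|0 - x0|), 0, 0.
  exists (M * `|0 + x0| - 0) => _ [x [r [Gx ->]]]; exact: LB.
pose c := sup L.
have cl x r : G (x, r) -> r - M * `|x - x0| <= c.
  by move=> Gx; apply: ub_le_sup => //; [case: L0|exists x, r].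
have cu x r : G (x, r) -> c <= M * `|x + x0| - r.
  by move=> Gx; apply: ge_sup; [case: L0|move=> _ [x' [r' [Gx' ->]]];
    exact: LB].
exists c.
  by move=> [x r] Gx; exists x, r, 0; rewrite scale0r mul0r !addr0.
have GZ a x r : G (x, r) -> G (a *: x, a * r).
  by move=> Gx; have := GD a _ _ _ _ Gx G0; rewrite !addr0.
split.
- by exists 0, 0, 0; rewrite scale0r mul0r !addr0.
- move=> a x r y s [x' [r' [t [Gx [-> ->]]]]] [y' [s' [u [Gy [-> ->]]]]].
  exists (a *: x' + y'), (a * r' + s'), (a * t + u); split; first exact: GD.
  rewrite scalerDr scalerDl scalerA addrACA; congr (_, _).
  by rewrite mulrDr mulrDl mulrA addrACA.
- move=> x r [x' [r' [t [Gx [-> ->]]]]].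
  have [t0|t0|->] := ltgtP t 0.
  + have E : x' + t *: x0 = (- t) *: ((- t)^-1 *: x' - x0).
      by rewrite scalerBr scalerA divff ?oppr_eq0 ?lt_eqF//
        scale1r scaleNr opprK.
    rewrite E normrZ normrN ltr0_norm//.
    have tN0 : 0 <= - t by rewrite oppr_ge0 ltW.
    have := ler_wpM2l tN0 (cl _ _ (GZ (- t)^-1 _ _ Gx)).
    rewrite mulrBr [- t * (_^-1 * _)]mulrA divff ?oppr_eq0 ?lt_eqF// mul1r; lra.
  + have E : x' + t *: x0 = t *: (t^-1 *: x' + x0).
      by rewrite scalerDr scalerA divff ?gt_eqF// scale1r.
    rewrite E normrZ gtr0_norm//.
    have := ler_wpM2l (ltW t0) (cu _ _ (GZ t^-1 _ _ Gx)).
    rewrite mulrBr [t * (t^-1 * _)]mulrA divff ?gt_eqF// mul1r; lra.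
  + by rewrite scale0r mul0r !addr0; exact: GM.
Qed.

Theorem hahn_banach M G : 0 <= M -> dominated_graph M G ->
  exists f, (forall x r, G (x, r) -> sval f x = r) /\
            forall x, `|sval f x| <= M * `|x|.
Proof.
move=> M0 GM.
have [H [GH HM maxH]] := Zorn_bigcup_above GM (@dominated_graph_bigcup M).
have Htot x : exists r, H (x, r).
  have [c Hc cM] := dominated_graph_extend x M0 HM.
  exists c; apply: (maxH _ Hc cM); exists 0, 0, 1.
  by rewrite !add0r scale1r mul1r; split=> //; case: HM.
have Hfun x r s : H (x, r) -> H (x, s) -> r = s.
  move=> Hr Hs; have [_ HD _] := HM.
  have := dominated_graph_norm HM (HD (-1) _ _ _ _ Hr Hs).
  rewrite scaleN1r addNr normr0 mulr0 normr_le0 mulN1r addrC subr_eq0.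
  by move=> /eqP.
pose g x : R^o := sval (cid (Htot x)).
have Hg x : H (x, g x) := svalP (cid (Htot x)).
have glin : linear g.
  move=> a x y; apply: (Hfun (a *: x + y)) => //.
  by have [_ HD _] := HM; exact: HD.
pose gl := GRing.isLinear.Build R X R^o *:%R g glin.
pose g' : {linear X -> R^o} := HB.pack g gl.
have gM x : `|g' x| <= M * `|x| by exact: dominated_graph_norm HM (Hg x).
have [f fg] := bounded_dual gM.
exists f; split=> [x r Gx|x]; rewrite fg //.
exact: Hfun (Hg x) (GH _ Gx).
Qed.

Definition linear_set (S : set X) : Prop :=
  S 0 /\ forall (a : R) x y, S x -> S y -> S (a *: x + y).

Lemma norming_functional x :
  exists f, sval f x = `|x| /\ forall y, `|sval f y| <= `|y|.
Proof.
have [|f [fG fM]] :=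
    @hahn_banach 1 [set u | exists t, u = (t *: x, t * `|x|)] ler01.
  split=> [|a y r z s [t [-> ->]] [u [-> ->]]|y r [t [-> ->]]].
  - by exists 0; rewrite scale0r mul0r.
  - by exists (a * t + u); rewrite scalerA -scalerDl mulrA -mulrDl.
  - by rewrite mul1r normrZ ler_wpM2r// ler_norm.
exists f; split=> [|y]; last by rewrite -[leRHS]mul1r.
by apply: fG; exists 1; rewrite scale1r mul1r.
Qed.

Lemma separating_functional (S : set X) x0 (d : R) :
  linear_set S -> 0 < d -> (forall s, S s -> d <= `|x0 - s|) ->
  exists f, sval f x0 = d /\ forall s, S s -> sval f s = 0.
Proof.
move=> [S0 SD] d0 Sd.
have [|f [fG fM]] := @hahn_banach 1
    [set u | exists t s, S s /\ u = (t *: x0 + s, t * d)] ler01.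
  split=> [|a y r z s [t [s1 [Ss1 [-> ->]]]] [u [s2 [Ss2 [-> ->]]]]
          |y r [t [s [Ss [-> ->]]]]].
  - by exists 0, 0; rewrite scale0r mul0r addr0.
  - exists (a * t + u), (a *: s1 + s2); split; first exact: SD.
    by rewrite scalerDr scalerA scalerDl addrACA mulrA -mulrDl.
  - rewrite mul1r; have [->|t0] := eqVneq t 0; first by rewrite mul0r.
    rewrite (_ : _ + s = t *: (x0 - (- t^-1 *: s + 0))); last first.
      by rewrite scalerBr addr0 scaleNr scalerN opprK scalerA divff// scale1r.
    rewrite normrZ (@le_trans _ _ (`|t| * d))//.
      by rewrite ler_wpM2r ?ler_norm// ltW.
    by rewrite ler_wpM2l// Sd//; exact: SD.
exists f; split=> [|s Ss]; apply: fG.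
  by exists 1, 0; rewrite scale1r mul1r addr0.
by exists 0, s; rewrite scale0r mul0r add0r.
Qed.

End functionals.

(** * Weak topology *)

Lemma fmap_ultra (T U : Type) (g : T -> U) (F : set_system T) :
  UltraFilter F -> UltraFilter (g @ F).
Proof.
move=> UF; split; first exact: fmap_proper_filter.
move=> G PG sub; apply/seteqP; split=> // A GA.
have [//|FnA] := in_ultra_setVsetC (g @^-1` A) UF.
by have [x []] := filter_ex (filterI GA (sub (~` A) FnA)).
Qed.

Lemma norm_denseP (R : realType) (X : normedModType R) (S : set X) :
  dense S <-> forall x (e : R), 0 < e -> exists2 s, S s & `|x - s| < e.
Proof.
split=> [dS x e e0|dS O [x Ox] oO].
  have [|s [xs Ss]] := dS (ball x e)^° _ (open_interior _).
    by exists x; exact: nbhsx_ballx.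
  by exists s => //; have := interior_subset xs; rewrite -ball_normE.
have /nbhs_ballP[e /= e0 xeO] : nbhs x O by exact: open_nbhs_nbhs.
have [s Ss xs] := dS x e e0.
by exists s; split=> //; apply: xeO; rewrite -ball_normE.
Qed.

Section weak_topology_theory.
Variables (R : realType) (X : normedModType R).

Lemma dual_axpy (f : dual X) (t : R) (a b : X) :
  sval f (t *: a + b) = t * sval f a + sval f b :> R.
Proof. by rewrite linearD linearZ. Qed.

Lemma dualB (f : dual X) (a b : X) :
  sval f (a - b) = (sval f a : R) - sval f b.
Proof. exact: linearB. Qed.

Lemma weak_cvgP (F : set_system X) (x : X) : Filter F ->
  (F --> (x : weak X)) <->
  forall (f : dual X) (e : R), 0 < e ->
    \forall y \near F, `|(sval f x : R) - sval f y| < e.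
Proof.
move=> FF; rewrite [X in X <-> _](cvg_sup _ _ FF).
split=> [Fx f e e0|Fx f A].
  have /(Fx f) : nbhs (x : initial_topology (sval f : X -> R^o))
      (sval f @^-1` ball (sval f x) e).
    apply: (@initial_continuous _ _ (sval f : X -> R^o) x).
    exact: nbhsx_ballx.
  by apply: filterS => y /=; rewrite -ball_normE.
rewrite nbhsE => -[_ [[B Bop <-] Bfx] BA].
have /nbhs_ballP[e /= e0 eB] : nbhs (sval f x) B by apply: open_nbhs_nbhs.
apply: filterS (Fx f e e0) => y xy; apply: BA => /=; apply: eB.
by rewrite -ball_normE.
Qed.

(** Compactness through ultrafilters: an ultrafilter has images under arbitrary
    maps that are again ultrafilters, so that auxiliary points may be chosen
    without any continuity. *)
Lemma weak_compactP (A : set X) : compact (A : set (weak X)) <->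
  forall F : set_system X, UltraFilter F -> F A ->
  exists2 x, A x & forall (f : dual X) (e : R), 0 < e ->
    \forall y \near F, `|(sval f x : R) - sval f y| < e.
Proof.
rewrite compact_ultra; split=> H F UF FA.
  by have [x [Ax /weak_cvgP xF]] := H F UF FA; exists x.
by have [x Ax xF] := H F UF FA; exists x; split=> //; apply/weak_cvgP.
Qed.

Lemma weak_coarser (x : X) : nbhs x --> (x : weak X).
Proof.
apply/weak_cvgP => f e e0; have := svalP f x.
by move/cvgrPdist_lt => /(_ _ e0).
Qed.

Lemma dense_weak (S : set X) : dense S -> dense (S : set (weak X)).
Proof.
move=> dS O [x Ox] oO.
have [|y []] := dS (O : set X)^° _ (open_interior _).
  exists x; apply: weak_coarser.
  exact: open_nbhs_nbhs.
by move=> /interior_subset Oy Sy; exists y.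
Qed.

Lemma weak_dense_near (S : set X) (f : dual X) (x : X) (e : R) : 0 < e ->
  dense (S : set (weak X)) -> exists2 y, S y & `|(sval f x : R) - sval f y| < e.
Proof.
move=> e0 dS.
pose O : set (weak X) := [set y | `|(sval f x : R) - sval f y| < e].
have nO : nbhs (x : weak X) O.
  have : nbhs (x : weak X) --> (x : weak X) by [].
  by move/weak_cvgP; apply.
have [|y [Oy Sy]] := dS O^° _ (open_interior _).
  by exists x.
by exists y => //; exact: interior_subset Oy.
Qed.

(** A functional vanishing on [S] and positive at a point away from [S] would
    separate this point from [S] weakly. *)
Lemma weak_dense_subspace (S : set X) : linear_set S ->
  dense (S : set (weak X)) -> dense S.
Proof.
move=> linS dS; apply/norm_denseP => x e e0; apply: contrapT => far.
have [|f [fx fS]] := separating_functional linS e0 (x0 := x).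
  by move=> s Ss; rewrite leNgt; apply/negP => xs; apply: far; exists s.
have [y Sy] := weak_dense_near f x e0 dS.
by rewrite fx fS// subr0 gtr0_norm// ltxx.
Qed.

Lemma weak_compact_axpy (A B : set X) (m : R) :
  compact (A : set (weak X)) -> compact (B : set (weak X)) ->
  compact ([set u | exists t a b, [/\ `|t| <= m, A a, B b & u = t *: a + b]]
    : set (weak X)).
Proof.
move=> /weak_compactP cA /weak_compactP cB; apply/weak_compactP => F UF.
set C := [set u | _] => FC.
have [u0 [_ [a0 [b0 [_ Aa0 Bb0 _]]]]] := filter_ex FC.
have /choice[d dP] : forall u, exists d : R * X * X, C u ->
    [/\ `|d.1.1| <= m, A d.1.2, B d.2 & u = d.1.1 *: d.1.2 + d.2].
  move=> u; have [[t [a [b Cu]]]|nC] := pselect (C u);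
    first by exists (t, a, b).
  by exists (0, a0, b0) => /nC.
pose t u := (d u).1.1; pose a u := (d u).1.2; pose b u := (d u).2.
have [|x Ax ax] := cA _ (fmap_ultra a UF).
  by apply: (@filterS _ F _ C (a @^-1` A)) => // u /dP[].
have [|y By yb] := cB _ (fmap_ultra b UF).
  by apply: (@filterS _ F _ C (b @^-1` B)) => // u /dP[].
have := @segment_compact R (- m) m; rewrite compact_ultra => seg.
have [|r [rm tr]] := seg _ (fmap_ultra t UF).
  apply: (@filterS _ F _ C (t @^-1` _)) => // u /dP[tm _ _ _].
  by rewrite /= in_itv /= -ler_norml.
exists (r *: x + y).
  by exists r, x, y; split=> //; move: rm; rewrite /= in_itv /= -ler_norml.
move=> f e e0; have [M M0 fM] := dual_bound f.
have m0 : 0 <= m by move: rm; rewrite /= in_itv /= -ler_norml; exact: le_trans.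
have e30 : 0 < e / 3 by rewrite divr_gt0.
have q0 : 0 < (e / 3) / (m + 1) by rewrite divr_gt0// ltr_wpDl.
have p0 : 0 < (e / 3) / (`|sval f x| + 1) by rewrite divr_gt0// ltr_wpDl.
have near1 : \forall u \near F, `|r - t u| < (e / 3) / (`|sval f x| + 1).
  by move/cvgrPdist_lt : tr => /(_ _ p0).
have near2 :
    \forall u \near F, `|(sval f x : R) - sval f (a u)| < (e / 3) / (m + 1).
  exact: ax f _ q0.
have near3 : \forall u \near F, `|(sval f y : R) - sval f (b u)| < e / 3.
  exact: yb f _ e30.
apply: filterS (filterI FC (filterI near1 (filterI near2 near3))).
move=> u /= [/dP[tm _ _ uE] [ru [xu yu]]].
rewrite uE !dual_axpy.
rewrite -/(t u) -/(a u) -/(b u) in tm *.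
set fx := sval f x in ru xu *; set fa := sval f (a u) in xu *.
set fy := sval f y in yu *; set fb := sval f (b u) in yu *.
have -> : r * fx + fy - (t u * fa + fb) =
    (r - t u) * fx + t u * (fx - fa) + (fy - fb) by ring.
have h1 : `|(r - t u) * fx| < e / 3.
  rewrite normrM; apply: (@le_lt_trans _ _ (`|r - t u| * (`|fx| + 1))).
    by rewrite ler_wpM2l// lerDl.
  by rewrite -ltr_pdivlMr// ltr_wpDl.
have h2 : `|t u * (fx - fa)| < e / 3.
  rewrite normrM; apply: (@le_lt_trans _ _ ((m + 1) * `|fx - fa|)).
    by rewrite ler_wpM2r// (le_trans tm)// lerDl.
  by rewrite mulrC -ltr_pdivlMr// ltr_wpDl.
apply: (le_lt_trans (ler_normD _ _));
  apply: (le_lt_trans (lerD (ler_normD _ _) (lexx _))).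
lra.
Qed.

End weak_topology_theory.

Lemma weak_compact_image (R : realType) (X Y : normedModType R)
    (T : {linear X -> Y}) (A : set X) : continuous T ->
  compact (A : set (weak X)) -> compact (T @` A : set (weak Y)).
Proof.
move=> cT /weak_compactP cA; apply/weak_compactP => F UF FTA.
have [_ [a0 Aa0 _]] := filter_ex FTA.
have /choice[g gP] : forall y, exists x, (T @` A) y -> A x /\ T x = y.
  by move=> y; have [[x Ax <-]|n] := pselect ((T @` A) y);
    [exists x|exists a0 => /n].
have [|x Ax xg] := cA _ (fmap_ultra g UF).
  by apply: (@filterS _ F _ _ (g @^-1` A)) FTA => y /gP[].
exists (T x); first by exists x.
move=> f e e0.
have [M M0 fM] := dual_bound f.
have [N N0 TN] : exists2 N : R, 0 < N & forall x, `|T x| <= N * `|x|.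
  have /linear_bounded_continuous/linear_boundedP := cT.
  by move=> /pinfty_ex_gt0[N N0 TN]; exists N.
have [|h hE] := @bounded_dual R X (sval f \o T) (M * N).
  by move=> z /=; rewrite (le_trans (fM _))// -mulrA ler_wpM2l// ltW.
have xh : \forall y \near F, `|(sval h x : R) - sval h (g y)| < e.
  exact: xg h e e0.
by apply: filterS (filterI FTA xh) => y [/gP[_ yE]] /=; rewrite !hE /= yE.
Qed.

(** * Generation by weakly compact sets *)

Lemma reindex_compacts (Z : topologicalType) (I L : Type) (K : I -> set Z) :
  [set: I] #<= [set: L] -> (forall i, compact (K i)) ->
  exists K' : L -> set Z, (forall l, compact (K' l)) /\
    \bigcup_l K' l = \bigcup_i K i.
Proof.
move=> /card_leTP[j j_inj] cK.
exists (fun l => [set z | exists i, j i = l /\ K i z]); split=> [l|].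
  have [[i <-]|nol] := pselect (exists i, j i = l).
    rewrite (_ : [set z | _] = K i) //; apply/seteqP;
      split=> [z [i' [/j_inj ->]]//|z Kz].
    by exists i.
  rewrite (_ : [set z | _] = set0); first exact: compact0.
  by rewrite -subset0 => z [i [ji _]]; apply: nol; exists i.
apply/seteqP; split=> [z [l _ [i [_ Kz]]]|z [i _ Kz]]; first by exists i.
by exists (j i) => //; exists i.
Qed.

Section span.
Variables (R : realType) (X : normedModType R).

Section combinations.
Variables (L : Type) (K : L -> set X).

(** The combinations [t1 *: a1 + ... + tn *: an], with [`|ti| <= m] and [ai] in
    [K li], where [s = [:: l1; ...; ln]]. *)
Fixpoint comb (s : seq L) (m : R) : set X :=
  if s is l :: s then
    [set u | exists t a b, [/\ `|t| <= m, K l a, comb s m b & u = t *: a + b]]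
  else [set 0].

Lemma comb_compact s m : (forall l, compact (K l : set (weak X))) ->
  compact (comb s m : set (weak X)).
Proof.
move=> cK; elim: s => [|l s IH]; first exact: compact_set1.
exact: weak_compact_axpy.
Qed.

Lemma comb_le s m m' : m <= m' -> comb s m `<=` comb s m'.
Proof.
move=> mm'; elim: s => [|l s IH] //= _ [t [a [b [tm Ka sb ->]]]].
by exists t, a, b; split=> //; [exact: le_trans mm'|exact: IH].
Qed.

Lemma comb_axpy s s' (m m' M : R) (c : R) x y : `|c| * m <= M -> m' <= M ->
  comb s m x -> comb s' m' y -> comb (s ++ s') M (c *: x + y).
Proof.
move=> cm m'M.
elim: s x => [x -> s'y|l s IH _ [t [a [b [tm Ka sb ->]]]] s'y] /=.
  by rewrite scaler0 add0r; exact: comb_le s'y.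
exists (c * t), a, (c *: b + y); split=> //.
- by rewrite normrM (le_trans _ cm)// ler_wpM2l.
- exact: IH.
- by rewrite scalerDr scalerA addrA.
Qed.

(** The linear span is the union of the sets [comb K s m] with [m] an integer,
    and there are as many pairs [(s, m)] as points in [L]. *)
Lemma compact_span : infinite_set [set: L] ->
  (forall l, compact (K l : set (weak X))) ->
  exists K' : L -> set (weak X), [/\ forall l, compact (K' l),
    \bigcup_l K l `<=` \bigcup_l K' l & linear_set (\bigcup_l K' l : set X)].
Proof.
move=> Linf cK.
have le : [set: seq L * nat] #<= [set: L].
  by apply: card_prod_le; [|apply: card_seq_le|apply/infiniteP].
have [|K' [cK' UK']] := @reindex_compacts (weak X) _ L
    (fun sm => comb sm.1 sm.2%:R) le.
  by move=> sm; exact: comb_compact.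
exists K'; split=> //.
  move=> x [l _ Kx]; rewrite UK'; exists ([:: l], 1%N) => //=.
  by exists 1, x, 0; split; rewrite ?normr1 ?scale1r ?addr0.
rewrite UK'; split=> [|a x y [[s m] _ sx] [[s' m'] _ s'y]];
  first by exists ([::], 0%N).
pose M := maxn (Num.bound (`|a| * m%:R)) m'.
exists (s ++ s', M) => //=; apply: comb_axpy sx s'y;
  last by rewrite ler_nat leq_maxr.
apply: le_trans (ltW (archi_boundP _)) _; first by rewrite mulr_ge0.
by rewrite ler_nat leq_maxl.
Qed.

End combinations.

(** The linear span of the compact sets is a weakly dense subspace, hence norm
    dense, and it is a union of as many compact sets. *)
Lemma CG_norm_dense (L : Type) : is_CG (weak X) L ->
  exists K : L -> set (weak X), (forall l, compact (K l)) /\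
    dense (\bigcup_l K l : set X).
Proof.
move=> [[Linf [K [cK dK]]] _].
have [K' [cK' KK' linK']] := compact_span Linf cK.
exists K'; split=> //; apply: weak_dense_subspace => //.
by move=> O O0 oO; have [x [Ox Kx]] := dK O O0 oO; exists x; split=> //;
  exact: KK'.
Qed.

Lemma CG_generated (I L : Type) (K : I -> set X) :
  infinite_set [set: L] -> [set: I] #<= [set: L] ->
  (forall i, compact (K i : set (weak X))) ->
  (forall S : set X, linear_set S -> \bigcup_i K i `<=` S -> dense S) ->
  exists K : L -> set (weak X),
    (forall l, compact (K l)) /\ dense (\bigcup_l K l).
Proof.
move=> Linf IL cK dK.
have [K0 [cK0 UK0]] :=
  reindex_compacts IL (cK : forall i, compact (K i : set (weak X))).
have [K' [cK' KK' SK']] := compact_span Linf cK0.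
exists K'; split=> //; apply: dense_weak; apply: dK => //.
by rewrite -[X in X `<=` _]UK0.
Qed.

End span.

(** * Approximation by weakly compact sets *)

Section closed_subspace_compact.
Variables (R : realType) (X : completeNormedModType R) (Y : closed_subspace X).

Lemma csub_dual_extend (f : dual (csub_type Y)) :
  exists g : dual X, forall y : csub_type Y, sval g (val y) = sval f y.
Proof.
have [M M0 fM] := dual_bound f.
have [|g [gf _]] :=
    @hahn_banach R X M [set u | exists y, u = (val y, sval f y)] (ltW M0).
  split=> [|a x r y s [x' [-> ->]] [y' [-> ->]]|x r [y [-> ->]]].
  - by exists 0; rewrite linear0 raddf0.
  - by exists (a *: x' + y'); rewrite dual_axpy linearP.
  - by rewrite (le_trans (ler_norm _)).
by exists g => y; apply: gf; exists y.
Qed.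

(** Grothendieck's criterion of weak compactness. Along an ultrafilter
    of the set, the points chosen in [K n] converge weakly to some [x n] in
    [K n]; norms decrease at weak limits, so that [x] is a Cauchy sequence,
    whose limit is the weak limit of the ultrafilter. This limit belongs to [Y],
    which is weakly closed, and it is also the weak limit in [Y], as functionals
    on [Y] extend to [X]. *)
Lemma approx_compact (K : nat -> set X) :
  (forall n, compact (K n : set (weak X))) ->
  compact ([set y | forall n, exists2 k, K n k & `|val y - k| <= n.+1%:R^-1]
    : set (weak (csub_type Y))).
Proof.
move=> cK; apply/weak_compactP => F UF; set W := [set y | _] => FW.
have [y0 Wy0] := filter_ex FW.
have /choice[k kP] : forall ny : nat * csub_type Y, exists k,
    W ny.2 -> K ny.1 k /\ `|val ny.2 - k| <= ny.1.+1%:R^-1.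
  move=> [n y] /=; have [/(_ n)[k Kk yk]|nW] := pselect (W y);
    first by exists k.
  by exists 0 => /nW.
have xP n : exists x, K n x /\ forall (f : dual X) (e : R), 0 < e ->
    \forall y \near F, `|(sval f x : R) - sval f (k (n, y))| < e.
  have /weak_compactP/(_ _ (fmap_ultra (fun y => k (n, y)) UF)) := cK n.
  case=> [|x Kx xk].
    by apply: (@filterS _ F _ W) => // y /(kP (n, y))[].
  by exists x; split.
move: xP => /choice[x /all_and2[Kx xk]].
have inv_small (e : R) : 0 < e -> \forall n \near \oo, n.+1%:R^-1 < e.
  move=> e0; exists (Num.bound e^-1) => // n /= Nn.
  rewrite invf_plt ?posrE//;
    have /archi_boundP e1 : 0 <= e^-1 by rewrite invr_ge0 ltW.
  by rewrite (lt_le_trans e1)// ler_nat (leq_trans Nn).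
have xx n m : `|x n - x m| <= n.+1%:R^-1 + m.+1%:R^-1.
  apply/ler_addgt0Pr => e e0.
  have [f [fx f1]] := norming_functional (x n - x m).
  have e20 : 0 < e / 2 by rewrite divr_gt0.
  have [y [Wy [ny my]]] :=
    filter_ex (filterI FW (filterI (xk n f _ e20) (xk m f _ e20))).
  have [_ /= kn] := kP (n, y) Wy; have [_ /= km] := kP (m, y) Wy.
  have fk : `|(sval f (k (n, y)) : R) - sval f (k (m, y))| <=
      n.+1%:R^-1 + m.+1%:R^-1.
    rewrite -dualB (le_trans (f1 _))//.
    rewrite (_ : _ - _ = (val y - k (m, y)) - (val y - k (n, y))); last first.
      by rewrite opprB [RHS]addrC addrA subrK.
    by rewrite (le_trans (ler_normB _ _))// addrC lerD.
  have fxE : (sval f (x n) : R) - sval f (x m) = `|x n - x m|.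
    by rewrite -fx dualB.
  move: ny my fk => /=; rewrite -fxE !ltr_norml !ler_norml.
  move: (n.+1%:R^-1) (m.+1%:R^-1) => p q.
  move=> /andP[? ?] /andP[? ?] /andP[? ?]; lra.
have xc : cauchy (x @ \oo).
  apply/cauchy_ballP => e e0.
  have e20 : 0 < e / 2 by rewrite divr_gt0.
  have := inv_small _ e20 => -[N _ HN].
  exists ([set x n | n in [set n | (N <= n)%N]],
    [set x n | n in [set n | (N <= n)%N]]).
    by split; exists N => // n /= Nn; exists n.
  move=> [_ _] [/= [n Nn <-] [m Nm <-]];
    rewrite -ball_normE /= (le_lt_trans (xx _ _))//.
  by rewrite (splitr e) ltrD//; exact: HN.
have /cvg_ex[l xl] : cvg (x @ \oo) by exact: cauchy_cvg.
have xnl n : `|x n - l| <= n.+1%:R^-1.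
  apply/ler_addgt0Pr => e e0.
  have e20 : 0 < e / 2 by rewrite divr_gt0.
  have /cvgrPdist_lt/(_ _ e20) lx := xl.
  have [m [lm im]] := filter_ex (filterI lx (inv_small _ e20)).
  rewrite (le_trans (ler_distD (x m) _ _))// [ `|x m - l|]distrC.
  move: (xx n m) lm im => /=; move: (n.+1%:R^-1) (m.+1%:R^-1) => p q; lra.
have lw (f : dual X) (e : R) : 0 < e ->
    \forall y \near F, `|(sval f l : R) - sval f (val y)| < e.
  move=> e0; have [M M0 fM] := dual_bound f.
  have q0 : 0 < (e / 3) / M by rewrite !divr_gt0.
  have e30 : 0 < e / 3 by rewrite divr_gt0.
  have [n nq] := filter_ex (inv_small _ q0).
  apply: filterS (filterI FW (xk n f _ e30)) => y [Wy fk].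
  have [_ /= yk] := kP (n, y) Wy.
  have nM : M * n.+1%:R^-1 < e / 3 by rewrite mulrC -ltr_pdivlMr.
  have h1 : `|(sval f (x n) : R) - sval f l| < e / 3.
    rewrite -dualB (le_lt_trans (fM _))// (le_lt_trans _ nM)//.
    by rewrite ler_wpM2l// ltW.
  have h2 : `|(sval f (val y) : R) - sval f (k (n, y))| < e / 3.
    rewrite -dualB (le_lt_trans (fM _))// (le_lt_trans _ nM)//.
    by rewrite ler_wpM2l// ltW.
  move: fk h1 h2 => /=; rewrite !ltr_norml.
  move=> /andP[? ?] /andP[? ?] /andP[? ?]; lra.
have Yl : csub_set Y l.
  apply: contrapT => nYl.
  have /nbhs_ballP[d /= d0 dY] : nbhs l (~` csub_set Y).
    by apply: open_nbhs_nbhs; split=> //; exact/closed_openC/csub_closed.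
  have linY : linear_set (csub_set Y) := conj (csub0 Y) (@csubP _ _ Y).
  have [|f [fl fY]] := separating_functional linY d0 (x0 := l).
    move=> s Ys; rewrite leNgt; apply/negP => ls; apply: (dY s) => //.
    by rewrite -ball_normE.
  have [y] := filter_ex (lw f d d0).
  by rewrite fl fY ?subr0 ?gtr0_norm ?ltxx//; exact/set_mem/valP.
exists (exist _ l (mem_set Yl) : csub_type Y).
  by move=> n; exists (x n) => //=; rewrite distrC.
move=> f e e0; have [g gf] := csub_dual_extend f.
by apply: filterS (lw g e e0) => y; rewrite -!gf.
Qed.

End closed_subspace_compact.

(** * Index of compact generation of subspaces *)

(** No point is a cluster point of the sets with finite complement in [A]. *)
Lemma discrete_compact_finite (T : discreteTopologicalType) (A : set T) :
  compact A -> finite_set A.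
Proof.
move=> cA; apply: contrapT => Ainf.
pose F : set_system T := [set B | finite_set (A `\` B)].
have FF : ProperFilter F.
  split; first by rewrite /F /= setD0.
  split=> [|B C FB FC|B C BC]; rewrite /F /=.
  - by rewrite setDT; exact: finite_set0.
  - by rewrite setDIr finite_setU.
  - by apply: sub_finite_set => x [Ax nC]; split=> // /BC.
have [|p [Ap Fp]] := cA F FF; first by rewrite /F /= setDv; exact: finite_set0.
have [|q [[_ /= qp]]] := Fp (A `\ p) [set p] _ (discrete_set1 p); last by [].
rewrite /F /=; apply: sub_finite_set (finite_set1 p) => x [Ax] nx.
by apply: contrapT => xp; apply: nx.
Qed.

Section seq_space_compact.
Variable K : Type.
Implicit Type C : set (seq_space K).

Lemma seq_space_proj_finite C (n : nat) :
  compact C -> finite_set [set x n | x in C].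
Proof.
move=> cC; apply: discrete_compact_finite.
apply: continuous_compact cC; apply: continuous_subspaceT.
exact: (@proj_continuous _ (fun=> discrete_topology {classic K}) n).
Qed.

Lemma seq_space_compact_box (F : nat -> set K) : (forall n, finite_set (F n)) ->
  compact ([set x | forall n, F n (x n)] : set (seq_space K)).
Proof.
move=> finF.
apply: (@tychonoff _ (fun=> discrete_topology {classic K}) F) => n.
exact: finite_compact.
Qed.

End seq_space_compact.

Lemma compact_bigcup_finite (Z : topologicalType) (I : Type) (D : set I)
    (K : I -> set Z) : finite_set D -> (forall i, compact (K i)) ->
  compact (\bigcup_(i in D) K i).
Proof.
elim/Pchoice: I D K => I D K finD cK.
by rewrite -bigsetU_fset_set//; exact: bigsetU_compact.
Qed.

Definition not_covered_by_fewer (K T : Type) (A : set (seq_space K)) : Prop :=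
  forall (I : Type) (C : I -> set (seq_space K)),
    [set: I] #<= [set: T] -> ~ ([set: T] #<= [set: I]) ->
    (forall i, compact (C i)) -> ~ (A `<=` \bigcup_i C i).

Lemma d_exists (K : Type) : exists d, is_d K d.
Proof.
apply: (@exists_least_card _ (seq_space K)) => [A B AB [C [cC CT]]|].
  have [|C' [cC' C'E]] := reindex_compacts (I := A) (L := B) _ cC.
    by have /card_eqPle[] := AB.
  by exists C'; rewrite C'E.
exists (fun x => [set x]); split; first by move=> x; exact: compact_set1.
by apply/seteqP; split=> // x _; exists x.
Qed.

Lemma d_infinite (K d : Type) : infinite_set [set: K] -> is_d K d ->
  infinite_set [set: d].
Proof.
move=> Kinf [[C [cC CT]] _] dfin; apply: Kinf.
have /(seq_space_proj_finite 0) := compact_bigcup_finite dfin cC.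
by rewrite CT; apply: sub_finite_set => x _; exists (fun=> x).
Qed.

Lemma b_le (K T D : Type) (A : set (seq_space K)) :
  not_covered_by_fewer T A ->
  A #<= [set: D] -> exists b, is_b K T b /\ [set: b] #<= [set: D].
Proof.
move=> AT AD.
have PA : A #= [set: A] by rewrite card_eq_sym card_setT.
have [||b bP] := @exists_least_card (fun L => exists A : set (seq_space K),
  A #= [set: L] /\ not_covered_by_fewer T A) A.
- move=> L L' LL' [B [BL BT]]; exists B; split=> //.
  exact: card_eq_trans LL'.
- by exists A.
exists b; split=> //; case: bP => _ /(_ A) bA.
apply: card_le_trans (bA _) _; first by exists A.
by rewrite (card_le_eql (card_setT A)).
Qed.

Section CG_subspace.
Variables (R : realType) (kappa : Type).
Variables (X : completeNormedModType R) (Y : closed_subspace X).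
Hypothesis CGX : is_CG (weak X) kappa.

(** If [K] generates [X], a point [y] of [Y] has a code in the sequence space:
    the [n]-th term tells which [K l] to use for approximating [y] within
    [n.+1^-1]. A compact set of codes uses finitely many [l] at each [n], hence
    the points with these codes lie in a weakly compact subset of [Y]. *)
Lemma CG_subspace_code : exists (f : csub_type Y -> seq_space kappa)
    (V : set (seq_space kappa) -> set (weak (csub_type Y))),
  (forall C, compact C -> compact (V C)) /\ forall C y, C (f y) -> V C y.
Proof.
have [K [cK dK]] := CG_norm_dense CGX.
have /choice[f fP] : forall y : csub_type Y, exists f : nat -> kappa,
    forall n, exists2 k, K (f n) k & `|val y - k| <= n.+1%:R^-1.
  move=> y; suff /choice[g gP] : forall n, exists l,
      exists2 k, K l k & `|val y - k| <= n.+1%:R^-1 by exists g.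
  move=> n; have [|k [l _ Kk] yk] := (norm_denseP _).1 dK (val y) n.+1%:R^-1 _.
    by rewrite invr_gt0.
  by exists l, k => //; exact: ltW.
exists f, (fun C => [set y | forall n, exists2 k,
  (\bigcup_(l in [set x n | x in C]) K l) k & `|val y - k| <= n.+1%:R^-1]).
split=> [C cC|C y Cfy n].
  apply: approx_compact => n; apply: compact_bigcup_finite => //.
  exact: seq_space_proj_finite.
have [k Kk yk] := fP y n; exists k => //; exists (f y n) => //.
by exists (f y).
Qed.

Lemma CG_subspace_cover : exists f : csub_type Y -> seq_space kappa,
  forall (D : set (csub_type Y)) (I : Type) (C : I -> set (seq_space kappa)),
    dense D -> (forall i, compact (C i)) -> f @` D `<=` \bigcup_i C i ->
    exists K : I -> set (weak (csub_type Y)),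
      (forall i, compact (K i)) /\ D `<=` \bigcup_i K i.
Proof.
have [f [V [cV fV]]] := CG_subspace_code.
exists f => D I C dD cC DC; exists (fun i => V (C i)); split=> [i|y Dy].
  exact: cV.
by have [i _ Ci] := DC (f y) (imageP f Dy); exists i => //; exact: fV.
Qed.

End CG_subspace.

(** The functionals are bounded on [K], hence on [D] and on the whole space. *)
Lemma weak_compact_dense_trivial (R : realType) (X : normedModType R)
    (K D : set X) : compact (K : set (weak X)) -> dense D -> D `<=` K ->
  forall x : X, x = 0.
Proof.
move=> cK dD DK x; apply: contrapT => /eqP x0.
have xn0 : 0 < `|x| by rewrite normr_gt0.
have [f [fx f1]] := norming_functional x.
have /choice[y yP] : forall n, exists y, D y /\ `|(n%:R / `|x|) *: x - y| < 1.
  move=> n; have [y Dy yn] := (norm_denseP D).1 dD ((n%:R / `|x|) *: x) 1 ltr01.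
  by exists y.
have fy n : n%:R - 1 < (sval f (y n) : R).
  have [_ yn] := yP n; have := le_lt_trans (f1 _) yn.
  rewrite dualB linearZ /= fx /GRing.scale /= divfK ?gt_eqF//.
  by rewrite ltr_norml => /andP[_]; lra.
have [U [UU yU]] := @ultraFilterLemma _ (y @ \oo) _.
have /weak_compactP/(_ U UU)[|p Kp pU] := cK.
  by apply: yU; exists 0%N => // n _; apply: DK; have [] := yP n.
have far : U [set z | (sval f p : R) + 1 < sval f z].
  apply: yU; exists (Num.bound (`|sval f p : R| + 2)) => // n /= Nn.
  apply: lt_trans (fy n); rewrite ltrBrDr.
  have := archi_boundP (_ : 0 <= `|sval f p : R| + 2);
    rewrite addr_ge0// => /(_ isT).
  rewrite -(ler_nat R) in Nn; have := ler_norm (sval f p : R); lra.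
have [z [fz]] := filter_ex (filterI far (pU f 1 ltr01)).
by rewrite /= ltr_norml => /andP[+ _]; move: fz => /=; lra.
Qed.

(** A covering of the codes of a dense subset of [Y] by infinitely many compact
    sets bounds [tau]. This applies to a covering of the whole sequence space,
    and to a covering of the codes of [delta] points. A finite covering of the
    latter would make [Y] weakly compact, hence trivial. *)
Theorem CG_subspace_bounds (R : realType) (kappa tau delta : Type)
    (X : completeNormedModType R) (Y : closed_subspace X) :
  infinite_set [set: kappa] -> infinite_set [set: delta] ->
  is_CG (weak X) kappa -> is_CG (weak (csub_type Y)) tau ->
  is_dens (csub_type Y) delta ->
  (exists d, is_d kappa d /\ [set: tau] #<= [set: d]) /\
  (exists b, is_b kappa tau b /\ [set: b] #<= [set: delta]).
Proof.
move=> kinf dinf CGX CGY [[D [dD Ddelta]] _].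
have [f fP] := CG_subspace_cover Y CGX.
have CGY_le (D' : set (csub_type Y)) (I : Type)
    (C : I -> set (seq_space kappa)) :
    infinite_set [set: I] -> dense D' -> (forall i, compact (C i)) ->
    f @` D' `<=` \bigcup_i C i -> [set: tau] #<= [set: I].
  move=> Iinf dD' cC fC; have [_] := CGY; apply; split=> //.
  have [K [cK DK]] := fP D' I C dD' cC fC; exists K; split=> //.
  by move=> O O0 oO; have [x [Ox Dx]] := dense_weak dD' O0 oO; exists x;
    split=> //; exact: DK.
split.
  have [d dP] := d_exists kappa; exists d; split=> //.
  have [[C [cC CT]] _] := dP.
  apply: (CGY_le setT d C) => //; [exact: d_infinite dP| |by rewrite CT].
  by move=> O [x Ox] _; exists x.
apply: (@b_le _ _ _ (f @` D)); last first.
  apply: card_le_trans (card_image_le _ _) _.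
  by have /card_eqPle[] := Ddelta.
move=> I C _ tauI cC fC.
have [Ifin|Iinf] := pselect (finite_set [set: I]); last first.
  by apply: tauI; apply: CGY_le fC.
have [K [cK DK]] := fP D I C dD cC fC.
have cU := compact_bigcup_finite Ifin cK.
have Y0 := weak_compact_dense_trivial cU dD DK.
apply: dinf; rewrite -(eq_finite_set Ddelta).
by apply: sub_finite_set (finite_set1 0) => y _; exact: Y0.
Qed.

(** * Banach space of bounded functions *)

Section bounded_functions.
Variables (R : realType) (J : Type).

Definition bounded_fun_pred : {pred J -> R^o} :=
  [pred f | `[< exists M : R, forall j, `|f j| <= M >]].

Definition linf : Type := {f : J -> R^o | bounded_fun_pred f}.

HB.instance Definition _ := [isSub for (@sval _ bounded_fun_pred) :
  linf -> (J -> R^o)].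
HB.instance Definition _ := [Choice of linf by <:].

Lemma bounded_fun_submod : submod_closed bounded_fun_pred.
Proof.
split; first by apply/asboolP; exists 0 => j; rewrite normr0.
move=> a f g /asboolP[M fM] /asboolP[N gN]; apply/asboolP;
  exists (`|a| * M + N) => j.
rewrite (le_trans (ler_normD _ _))// lerD//.
by rewrite /GRing.scale /= normrM ler_wpM2l.
Qed.

HB.instance Definition _ := GRing.SubChoice_isSubLmodule.Build
  R (J -> R^o) bounded_fun_pred linf bounded_fun_submod.

Implicit Types u v : linf.

Definition linf_app u (j : J) : R := sval u j.

Lemma linf_axpy a u v j :
  linf_app (a *: u + v) j = a * linf_app u j + linf_app v j.
Proof. by []. Qed.

Lemma linf_eq u v : linf_app u =1 linf_app v -> u = v.
Proof. by move=> uv; apply: val_inj; apply/funext => j; exact: uv. Qed.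

Lemma linf_of (f : J -> R) (M : R) : (forall j, `|f j| <= M) ->
  exists u, forall j, linf_app u j = f j.
Proof.
move=> fM; have fP : bounded_fun_pred (f : J -> R^o) by apply/asboolP; exists M.
by exists (exist _ (f : J -> R^o) fP).
Qed.

(** Adding [0] to the values makes the supremum meaningful when [J] is empty. *)
Let norms u : set R := [set r | r = 0 \/ exists j, r = `|linf_app u j|].
Let linf_norm u : R := sup (norms u).

Let norms_sup u : has_sup (norms u).
Proof.
split; first by exists 0; left.
have /asboolP[M uM] := valP u; exists (Num.max 0 M) => _ [->|[j ->]].
  by rewrite le_max lexx.
by rewrite le_max uM orbT.
Qed.

Let linf_app_le u j : `|linf_app u j| <= linf_norm u.
Proof. by apply: ub_le_sup; [case: (norms_sup u)|right; exists j]. Qed.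

Let linf_norm_ge0 u : 0 <= linf_norm u.
Proof. by apply: ub_le_sup; [case: (norms_sup u)|left]. Qed.

Let linf_norm_le u (M : R) :
  0 <= M -> (forall j, `|linf_app u j| <= M) -> linf_norm u <= M.
Proof.
move=> M0 uM; apply: ge_sup; first by exists 0; left.
by move=> _ [->|[j ->]].
Qed.

Let linf_normD u v : linf_norm (u + v) <= linf_norm u + linf_norm v.
Proof.
apply: linf_norm_le => [|j]; first by rewrite addr_ge0.
have -> : linf_app (u + v) j = linf_app u j + linf_app v j by [].
by rewrite (le_trans (ler_normD _ _))// lerD.
Qed.

Let linf_normZ (a : R) u : linf_norm (a *: u) = `|a| * linf_norm u.
Proof.
have le (b : R) v : linf_norm (b *: v) <= `|b| * linf_norm v.
  apply: linf_norm_le => [|j]; first by rewrite mulr_ge0.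
  have -> : linf_app (b *: v) j = b * linf_app v j by [].
  by rewrite normrM ler_wpM2l.
apply/eqP; rewrite eq_le le /=.
have [->|a0] := eqVneq a 0; first by rewrite normr0 mul0r.
rewrite -ler_pdivlMl ?normr_gt0// -normfV (le_trans _ (le _ _))//.
by rewrite scalerA mulVf// scale1r.
Qed.

Let linf_norm_eq0 u : linf_norm u = 0 -> u = 0.
Proof.
move=> u0; apply: linf_eq => j; apply/eqP; rewrite -normr_le0 -u0.
exact: linf_app_le.
Qed.

HB.instance Definition _ := Lmodule_isNormed.Build R linf
  linf_normD linf_normZ linf_norm_eq0.

Lemma linf_app_norm u j : `|linf_app u j| <= `|u|.
Proof. exact: linf_app_le. Qed.

Lemma linf_norm_leP u (M : R) :
  0 <= M -> (forall j, `|linf_app u j| <= M) -> `|u| <= M.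
Proof. exact: linf_norm_le. Qed.

Lemma linf_complete (F : set_system linf) :
  ProperFilter F -> cauchy F -> cvg F.
Proof.
move=> FF /cauchy_ballP Fc.
have small (e : R) : 0 < e -> exists A B, [/\ F A, F B &
    forall u v, A u -> B v -> `|u - v| < e].
  move=> e0; have [[A B] [/= FA FB] AB] := Fc e e0.
  by exists A, B; split=> // u v Au Bv; have := AB (u, v) (conj Au Bv);
    rewrite -ball_normE.
have lP j : exists l : R, linf_app^~ j @ F --> l.
  have FjF : ProperFilter (linf_app^~ j @ F) by exact: fmap_proper_filter.
  suff Fj : cauchy (linf_app^~ j @ F) by apply/cvg_ex; exact: cauchy_cvg.
  apply/cauchy_ballP => e e0; have [A [B [FA FB AB]]] := small e e0.
  exists (linf_app^~ j @` A, linf_app^~ j @` B).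
    by split; [apply: (@filterS _ F _ A)|apply: (@filterS _ F _ B)] => // u;
      exists u.
  move=> [_ _] [[u Au <-] [v Bv <-]]; rewrite -ball_normE /=.
  apply: le_lt_trans (AB u v Au Bv).
  exact: (linf_app_norm (u - v)).
move: lP => /choice[l Fl].
have close (e : R) : 0 < e ->
    exists2 A, F A & forall u j, A u -> `|linf_app u j - l j| <= e.
  move=> e0; have [A [B [FA FB AB]]] := small e e0.
  exists A => // u j Au; apply/ler_addgt0Pr => d d0.
  have /cvgrPdist_lt/(_ d d0) Fd := Fl j.
  have [v [Bv /= lv]] := filter_ex (filterI FB Fd).
  rewrite (le_trans (ler_distD (linf_app v j) _ _))// lerD//; last first.
    by rewrite distrC ltW.
  by rewrite ltW// (le_lt_trans _ (AB u v Au Bv))//;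
    exact: (linf_app_norm (u - v)).
have [A1 FA1 A1l] := close 1 ltr01.
have [u1 Au1] := filter_ex FA1.
have [|g gl] := @linf_of l (`|u1| + 1).
  move=> j; have := A1l u1 j Au1; rewrite distrC => ul.
  rewrite -[l j](subrK (linf_app u1 j)) addrC (le_trans (ler_normD _ _))//
    lerD//.
apply/cvg_ex; exists g; apply/cvgrPdist_le => e e0.
have [A FA Al] := close e e0; apply: filterS FA => u Au.
apply: linf_norm_leP => [|j]; first exact: ltW.
have -> : linf_app (g - u) j = linf_app g j - linf_app u j by [].
by rewrite gl distrC Al.
Qed.

HB.instance Definition _ := Uniform_isComplete.Build linf linf_complete.

End bounded_functions.

(** * Closed spans, density and weakly null families *)

Section closed_span.
Variables (R : realType) (X : completeNormedModType R) (G : Type) (z : G -> X).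

Definition lspan : set X :=
  [set x | exists s : seq (R * G), x = \sum_(p <- s) p.1 *: z p.2].

Lemma lspan_linear : linear_set lspan.
Proof.
split=> [|a x y [s ->] [t ->]]; first by exists [::]; rewrite big_nil.
exists ([seq (a * p.1, p.2) | p <- s] ++ t).
rewrite big_cat big_map scaler_sumr; congr (_ + _).
by apply: eq_bigr => p _; rewrite scalerA.
Qed.

Lemma lspan_gen g : lspan (z g).
Proof. by exists [:: (1, g)]; rewrite big_seq1 scale1r. Qed.

Lemma lspan_min (S : set X) :
  linear_set S -> (forall g, S (z g)) -> lspan `<=` S.
Proof.
move=> [S0 SD] Sz _ [s ->]; elim: s => [|p s IH]; first by rewrite big_nil.
by rewrite big_cons; exact: SD.
Qed.

Definition closed_span_set : set X :=
  [set x | forall e : R, 0 < e -> exists2 s, lspan s & `|x - s| < e].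

Lemma lspan_closed_span : lspan `<=` closed_span_set.
Proof. by move=> x sx e e0; exists x => //; rewrite subrr normr0. Qed.

Lemma closed_span0 : closed_span_set 0.
Proof. by apply: lspan_closed_span; case: lspan_linear. Qed.

Lemma closed_spanP (a : R) (x y : X) :
  closed_span_set x -> closed_span_set y -> closed_span_set (a *: x + y).
Proof.
move=> sx sy e e0; have [_ SD] := lspan_linear.
have a0 : 0 < `|a| + 1 by rewrite ltr_wpDl.
have e20 : 0 < e / 2 by rewrite divr_gt0.
have [x' sx' xx'] := sx (e / 2 / (`|a| + 1)) (divr_gt0 e20 a0).
have [y' sy' yy'] := sy (e / 2) e20.
exists (a *: x' + y'); first exact: SD.
rewrite opprD addrACA -scalerBr (le_lt_trans (ler_normD _ _))//.
rewrite (splitr e) ltrD// normrZ.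
apply: (@le_lt_trans _ _ ((`|a| + 1) * `|x - x'|)).
  by rewrite ler_wpM2r// lerDl.
by rewrite mulrC -ltr_pdivlMr.
Qed.

Lemma closed_span_closed : closed closed_span_set.
Proof.
move=> x clx e e0; have e20 : 0 < e / 2 by rewrite divr_gt0.
have [|y [sy xy]] := clx (ball x (e / 2)); first exact: nbhsx_ballx.
have [s ls ys] := sy (e / 2) e20.
exists s => //; rewrite (le_lt_trans (ler_distD y _ _))// (splitr e) ltrD//.
by move: xy; rewrite -ball_normE.
Qed.

Definition closed_span : closed_subspace X :=
  ClosedSubspace closed_span0 closed_spanP closed_span_closed.

Lemma closed_span_gen g : closed_span_set (z g).
Proof. exact/lspan_closed_span/lspan_gen. Qed.

Lemma closed_span_vanish (h : X -> R) (M : R) :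
  (forall (a : R) x y, h (a *: x + y) = a * h x + h y) ->
  (forall x, `|h x| <= M * `|x|) ->
  (forall g, h (z g) = 0) -> forall x, closed_span_set x -> h x = 0.
Proof.
move=> hD hM hz x sx; apply/eqP; rewrite -normr_le0; apply/ler_addgt0Pr => e e0.
have M0 : 0 < `|M| + 1 by rewrite ltr_wpDl.
have [s ls xs] := sx (e / (`|M| + 1)) (divr_gt0 e0 M0).
have hs : h s = 0.
  apply: (lspan_min (S := [set s | h s = 0]) _ _ ls) => //.
  split=> [|a u v hu hv]; last by rewrite /= hD hu hv mulr0 addr0.
  by apply/eqP; rewrite -normr_le0 (le_trans (hM _))// normr0 mulr0.
have -> : h x = h (-1 *: s + x) by rewrite hD hs mulr0 add0r.
rewrite scaleN1r addrC add0r (le_trans (hM _))//.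
apply: (@le_trans _ _ ((`|M| + 1) * `|x - s|)).
  by rewrite ler_wpM2r// (le_trans (ler_norm _))// lerDl.
by rewrite mulrC -ler_pdivlMr// ltW.
Qed.

Lemma closed_span_dense (S : set (csub_type closed_span)) : linear_set S ->
  (forall y, (exists g, val y = z g) -> S y) -> dense S.
Proof.
move=> [S0 SD] Sz; apply/norm_denseP => x e e0.
have [s ls xs] := set_mem (valP x) e e0.
have [y Sy ys] : exists2 y : csub_type closed_span, S y & val y = s.
  pose S' := [set s | exists2 y : csub_type closed_span, S y & val y = s].
  apply: (lspan_min (S := S') _ _ ls).
    split=> [|a _ _ [u Su <-] [v Sv <-]]; first by exists 0 => //;
      exact: raddf0.
    by exists (a *: u + v); [exact: SD|rewrite linearP].
  move=> g; exists (exist _ (z g) (mem_set (closed_span_gen g)) :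
    csub_type closed_span) => //.
  by apply: Sz; exists g.
by exists y => //; move: xs; rewrite -ys.
Qed.

End closed_span.

Section density.
Variables (R : realType) (Z : completeNormedModType R) (G : Type) (z : G -> Z).

Definition rat_span : set Z :=
  range (fun s : seq (rat * G) => \sum_(p <- s) (ratr p.1 : R) *: z p.2).

Lemma rat_span_approx x (e : R) : lspan z x -> 0 < e ->
  exists2 y, rat_span y & `|x - y| < e.
Proof.
move=> [s ->]; elim: s e => [|p s IH] e e0.
  by exists 0; [exists [::] => //;
    rewrite big_nil|rewrite big_nil subrr normr0].
have e20 : 0 < e / 2 by rewrite divr_gt0.
have z0 : 0 < `|z p.2| + 1 by rewrite ltr_wpDl.
have [_ [t _ <-] st] := IH _ e20.
pose r := e / 2 / (`|z p.2| + 1).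
have r0 : 0 < r by rewrite divr_gt0.
have [q] : exists q : rat, (ratr q : R) \in `](p.1 - r), (p.1 + r)[.
  by apply: rat_in_itvoo; rewrite ltrBlDr -addrA ltrDl addr_gt0.
rewrite in_itv /= -ltr_distlC => pq.
exists (ratr q *: z p.2 + \sum_(u <- t) ratr u.1 *: z u.2).
  by exists ((q, p.2) :: t) => //; rewrite big_cons.
rewrite big_cons opprD addrACA -scalerBl (le_lt_trans (ler_normD _ _))//.
rewrite (splitr e) ltrD// normrZ.
apply: (@le_lt_trans _ _ (`|p.1 - ratr q| * (`|z p.2| + 1))).
  by rewrite ler_wpM2l// lerDl.
by rewrite -ltr_pdivlMr.
Qed.

Lemma rat_span_dense : dense (lspan z) -> dense rat_span.
Proof.
move=> /norm_denseP dz; apply/norm_denseP => x e e0.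
have e20 : 0 < e / 2 by rewrite divr_gt0.
have [s ls xs] := dz x _ e20; have [y ry sy] := rat_span_approx ls e20.
by exists y => //; rewrite (le_lt_trans (ler_distD s _ _))// (splitr e) ltrD.
Qed.

Lemma rat_span_card : infinite_set [set: G] -> rat_span #<= [set: G].
Proof.
move=> Ginf; apply: card_le_trans (card_image_le _ _) _.
apply: card_seq_le => //; apply: card_prod_le => //.
by rewrite (card_le_eql card_rat); apply/infiniteP.
Qed.

Lemma separated_is_dens : infinite_set [set: G] -> dense (lspan z) ->
  (forall g g', g <> g' -> 1 <= `|z g - z g'|) -> is_dens Z G.
Proof.
move=> Ginf dz sep.
have low (D : set Z) : dense D -> [set: G] #<= D.
  move=> /norm_denseP dD; have h0 : 0 < 1 / 2 :> R by rewrite divr_gt0.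
  have /choice[d dP] : forall g, exists d, D d /\ `|z g - d| < 1 / 2.
    by move=> g; have [d Dd gd] := dD (z g) _ h0; exists d.
  rewrite -(card_le_eqr (card_setT D)); apply/card_leTP.
  exists (fun g => SigSub (mem_set (dP g).1) : D) => g g' [dgg'].
  apply: contrapT => /sep; rewrite leNgt => /negP; apply.
  have := (dP g').2; rewrite -dgg' distrC => gd'.
  rewrite (le_lt_trans (ler_distD (d g) _ _))// [X in _ < X]splitr ltrD//.
  exact: (dP g).2.
have dr := rat_span_dense dz.
split; last first.
  by move=> L [D [dD DL]]; rewrite -(card_le_eqr DL); exact: low.
exists rat_span; split=> //; rewrite card_eq_le rat_span_card//; exact: low.
Qed.

End density.

Section c0_family.
Variables (R : realType) (Z : normedModType R).
Variables (G : Type) (z : G -> Z) (P : set G).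

(** A functional [f] takes values of modulus at least [e] at finitely many [z g]
    only: the sum of [n] of them, with the signs of the values, has norm at most
    [M] and value at least [n * e]. Thus [z] tends weakly to [0] on [P]. *)
Lemma c0_family_compact (M : R) :
  (forall (s : seq {classic G}) (c : G -> R), uniq s ->
    (forall g, g \in s -> P g) -> (forall g, `|c g| <= 1) ->
    `|\sum_(g <- s) c g *: z g| <= M) ->
  compact ([set 0] `|` z @` P : set (weak Z)).
Proof.
move=> zM; apply/weak_compactP => F UF; set A := _ `|` _ => FA.
have [[x Ax Fx]|noF] := pselect (exists2 x, A x & F [set x]).
  exists x => // f e e0; apply: filterS Fx => _ ->.
  by rewrite /= subrr normr0.
exists 0; first by left.
move=> f e e0; have [N N0 fN] := dual_bound f.
pose D : set {classic G} := [set g | P g /\ e <= `|sval f (z g)|].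
have finD : finite_set D.
  apply: contrapT => infD.
  have [B BD Bn] := infinite_set_fset (Num.bound (N * M / e)).+1 infD.
  pose c g : R := Num.sg (sval f (z g) : R).
  have := zM (enum_fset B) c (fset_uniq B).
  move=> /(_ (fun g gB => (BD g gB).1)) => /(_ _)/= Mc.
  have {}Mc : `|\sum_(g <- enum_fset B) c g *: z g| <= M.
    by apply: Mc => g; rewrite normr_sg lern1 leq_b1.
  have := le_trans (fN _) (ler_wpM2l (ltW N0) Mc).
  rewrite leNgt => /negP; apply.
  have fc : sval f (\sum_(g <- enum_fset B) c g *: z g) =
      \sum_(g <- enum_fset B) `|sval f (z g) : R| :> R.
    rewrite linear_sum; apply: eq_bigr => g _.
    by rewrite linearZ /= /GRing.scale /= /c normrEsg.
  rewrite fc; apply: lt_le_trans (ler_norm _).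
  have : \sum_(g <- enum_fset B) e <=
      \sum_(g <- enum_fset B) `|sval f (z g) : R|.
    rewrite big_seq [leRHS]big_seq; apply: ler_sum => g gB.
    by have [] := BD g gB.
  apply: lt_le_trans; rewrite big_const_seq count_predT iter_addr_0.
  rewrite -mulr_natr -ltr_pdivrMl// [_^-1 * _]mulrC.
  have M0 : 0 <= M.
    have := zM [::] c isT; rewrite big_nil normr0; apply=> // g.
    by rewrite normr_sg lern1 leq_b1.
  have NM : 0 <= N * M / e by rewrite divr_ge0 ?(mulr_ge0 (ltW N0))// ltW.
  rewrite (lt_le_trans (archi_boundP NM))// ler_nat.
  exact: leq_trans Bn.
have FD : F (~` (z @` D)).
  have FnD g : D g -> F (~` [set z g]).
    move=> [Pg _]; have [Fz|//] := in_ultra_setVsetC [set z g] UF.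
    by case: noF; exists (z g) => //; right; exists g.
  rewrite (_ : ~` _ = \bigcap_(g in [set` fset_set D]) ~` [set z g]).
    apply: filter_bigI => g; rewrite in_fset_set// => /set_mem; exact: FnD.
  apply/seteqP; split=> [x nx g /=|x nx [g Dg gx]].
    by rewrite in_fset_set// => /set_mem Dg xg; apply: nx; exists g.
  by apply: (nx g) => //=; rewrite in_fset_set//; exact: mem_set.
apply: filterS (filterI FA FD) => x [[->|[g Pg <-]] nD].
  by rewrite /= subrr normr0.
rewrite /= linear0 sub0r normrN ltNge; apply/negP => fe.
by apply: nD; exists g.
Qed.

End c0_family.

Section linf_families.
Variables (R : realType) (J : Type).
Local Notation B := (linf R J).

Lemma linf_eval (j : J) : exists f : dual B, forall u, sval f u = linf_app u j.
Proof.
pose ev u : R^o := linf_app (u : B) j.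
have evlin : linear ev by [].
pose evl : {linear B -> R^o} :=
  HB.pack ev (GRing.isLinear.Build R B R^o *:%R ev evlin).
have [|f fE] := @bounded_dual R B evl 1; last by exists f.
by move=> u; rewrite mul1r; exact: linf_app_norm.
Qed.

Section isometry.
Variables (Z : normedModType R) (T : {linear Z -> B}).
Hypothesis Tiso : forall x, `|T x| = `|x|.

Lemma isometry_continuous : continuous T.
Proof.
apply/linear_bounded_continuous/bounded_funP => r; exists r => x.
by rewrite Tiso.
Qed.

Lemma isometry_eval (j : J) :
  exists f : dual Z, forall x, sval f x = linf_app (T x) j.
Proof.
have [f fE] := linf_eval j.
have [|h hE] := @bounded_dual R Z (sval f \o T) 1; last first.
  by exists h => x; rewrite hE /= fE.
by move=> x /=; rewrite fE mul1r -Tiso; exact: linf_app_norm.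
Qed.

End isometry.

(** Functions with disjoint supports, bounded by [1], have the same
    linear combinations as the unit vectors of [c_0]. *)
Lemma disjoint_family_compact (Z : normedModType R) (T : {linear Z -> B})
    (G : Type) (z : G -> Z) (P : set G) :
  (forall x, `|T x| = `|x|) ->
  (forall g j, `|linf_app (T (z g)) j| <= 1) ->
  (forall g g' j, P g -> P g' -> linf_app (T (z g)) j != 0 ->
    linf_app (T (z g')) j != 0 -> g = g') ->
  compact ([set 0] `|` z @` P : set (weak Z)).
Proof.
move=> Tiso z1 zdisj; apply: (@c0_family_compact _ _ _ _ _ 1) => s c us sP c1.
rewrite -Tiso; apply: linf_norm_leP => // j.
have -> : linf_app (T (\sum_(g <- s) c g *: z g)) j =
    \sum_(g <- s) c g * linf_app (T (z g)) j.
  have [f fE] := linf_eval j; rewrite -fE !linear_sum; apply: eq_bigr => g _.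
  by rewrite !linearZ /= fE.
have [[g gs zg]|no] := pselect (exists2 g, g \in s & linf_app (T (z g)) j != 0).
  rewrite (bigD1_seq g)//= big1_seq ?addr0.
    by rewrite normrM mulr_ile1.
  move=> g' /andP[g'g g's]; have [->|zg'] := eqVneq (linf_app (T (z g')) j) 0.
    by rewrite mulr0.
  by case/eqP: g'g; apply: zdisj zg' zg; exact: sP.
rewrite big1_seq ?normr0// => g /andP[_ gs].
have [->|zg] := eqVneq (linf_app (T (z g)) j) 0; first by rewrite mulr0.
by case: no; exists g.
Qed.

End linf_families.

(** * Unit vectors of a hereditary family *)

Section hereditary_family.
Variables (R : realType) (Delta : Type) (Fam : set (set Delta)).
Hypothesis Fam_sub : forall C C', C' `<=` C -> Fam C -> Fam C'.
Local Notation B := (linf R (set Delta)).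
Implicit Types (C S : set Delta) (d : Delta).

Let coord_fun d C : R := if `[< Fam C /\ C d >] then 1 else 0.

Let coord_fun_le d C : `|coord_fun d C| <= 1.
Proof. by rewrite /coord_fun; case: ifP => _; rewrite ?normr0 ?normr1. Qed.

(** The unit vectors of a space of functions on [Delta]. Such a function [x] is
    represented by its sums over the members of the family, and the supremum of
    these sums is equivalent to the supremum, over [C] in the family, of the
    [l_1]-norm of [x] on [C]. *)
Definition coord d : B := sval (cid (linf_of (coord_fun_le d))).

Lemma coordE d C : Fam C -> linf_app (coord d) C = `[< C d >]%:R.
Proof.
rewrite /coord; case: cid => u /= -> FC; rewrite /coord_fun.
by case: asboolP => [[_ /asboolP->]|nC] //; case: asboolP => // Cd; case: nC.
Qed.

Lemma coord_out d C : ~ Fam C -> linf_app (coord d) C = 0.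
Proof.
rewrite /coord; case: cid => u /= -> FC; rewrite /coord_fun.
by case: asboolP => [[]|].
Qed.

Local Notation Xs := (closed_span_set coord).

Lemma closed_span_coord_add (u : B) C d :
  Xs u -> Fam (C `|` [set d]) -> ~ C d ->
  linf_app u (C `|` [set d]) = linf_app u C + linf_app u [set d].
Proof.
move=> Xu FCd nCd.
have FC : Fam C by apply: Fam_sub FCd => x; left.
have Fd : Fam [set d] by apply: Fam_sub FCd => x; right.
pose h (v : B) : R :=
  linf_app v (C `|` [set d]) - (linf_app v C + linf_app v [set d]).
apply/eqP; rewrite -subr_eq0; apply/eqP.
apply: (@closed_span_vanish R _ _ coord h 3) Xu => [a x y|x|c].
- by rewrite /h !linf_axpy; ring.
- rewrite /h (le_trans (ler_normB _ _))//.
  have := linf_app_norm x C; have := linf_app_norm x [set d].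
  have := linf_app_norm x (C `|` [set d]).
  have := ler_normD (linf_app x C) (linf_app x [set d]); lra.
- rewrite /h !coordE//; case: (asboolP (C c)) => Cc.
    rewrite asboolT; last by left.
    by rewrite asboolF ?addr0 ?subrr// => cd; apply: nCd; rewrite -cd.
  case: (asboolP ([set d] c)) => cd.
    by rewrite asboolT ?add0r ?subrr//; right.
  by rewrite asboolF ?addr0 ?subrr// => -[].
Qed.

(** A combination of unit vectors depends on finitely many points, and [u] is a
    uniform limit of such combinations. *)
Lemma closed_span_coord_tail (u : B) (e : R) : Xs u -> 0 < e ->
  exists2 S, finite_set S & forall C C', Fam C -> Fam C' ->
    C `&` S = C' `&` S -> `|linf_app u C - linf_app u C'| <= e.
Proof.
move=> Xu e0; have e20 : 0 < e / 2 by rewrite divr_gt0.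
have [_ [s ->] us] := Xu _ e20.
pose S := [set p.2 | p in [set` (s : seq {classic R * Delta})]]; exists S.
  by apply: finite_image; exact: finite_seq.
move=> C C' FC FC' CC'; set v : B := \sum_(p <- s) _ in us.
have vE K : linf_app v K = \sum_(p <- s) p.1 * linf_app (coord p.2) K.
  have [f fE] := linf_eval R K; rewrite -fE linear_sum; apply: eq_bigr => p _.
  by rewrite linearZ /= fE.
have vCC' : linf_app v C = linf_app v C'.
  rewrite !vE; apply: (@eq_big_seq _ _ _ {classic R * Delta}) => p ps.
  rewrite !coordE//; congr (_ * (nat_of_bool _)%:R).
  have Sp : S p.2 by exists p.
  apply: asbool_equiv_eq; split=> Cp.
    by have : (C `&` S) p.2 by []; rewrite CC' => -[].
  by have : (C' `&` S) p.2 by []; rewrite -CC' => -[].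
rewrite (le_trans (ler_distD (linf_app v C) _ _))//.
rewrite [X in _ <= X]splitr lerD//; last first.
  by rewrite vCC' distrC (le_trans (linf_app_norm (u - v) _))// ltW.
by rewrite (le_trans (linf_app_norm (u - v) _))// ltW.
Qed.

(** On a member [F] of the family, the space induces [l_1], where weakly compact
    sets are norm compact (Schur); as a consequence finitely many coordinates in
    [F] exceed [e] on [W]. The proof is a gliding hump. Infinitely many points
    [d n] of [F] with [`|w n [set d n]| > e] may be chosen so that [w n] is
    almost supported by a finite set [S n.+1] that contains [d n] and that no
    later [d m] meets. Let [v] be a weak cluster point of [w]. A subset [H] of
    the [d n] is built step by step: the values of [w n] on [G n] with and
    without [d n] differ by more than [e], so one of the choices makes the value
    of [w n] differ by [e / 2] from that of [v] on [G n]. The points added later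
    hardly change the value of [w n], and for large [n] those from [d n] on
    hardly change that of [v]. So the values of [w n] at [H] stay away from the
    value of [v], although [v] is a weak cluster point. *)
Theorem weak_compact_coords (W : set B) (F : set Delta) (e : R) :
  compact (W : set (weak B)) -> W `<=` Xs -> Fam F -> 0 < e ->
  finite_set [set d | F d /\ exists2 w, W w & e < `|linf_app w [set d]|].
Proof.
move=> /weak_compactP cW WX FF e0; apply: contrapT.
set T := [set d | _] => Tinf.
have e80 : 0 < e / 8 by rewrite divr_gt0.
have FamF C : C `<=` F -> Fam C by move=> /Fam_sub; exact.
(* a step of the gliding hump: a new point [t.1.1] of [T], a witness [t.1.2]
   and a finite set [t.2] supporting the witness up to [e / 8] *)
have /choice[hump humpP] : forall S : {S : set Delta | finite_set S},
    exists t : Delta * B * {S : set Delta | finite_set S},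
    [/\ T t.1.1 /\ ~ sval S t.1.1, W t.1.2 /\ e < `|linf_app t.1.2 [set t.1.1]|,
        sval S `<=` sval t.2 /\ sval t.2 t.1.1 &
        forall C C', Fam C -> Fam C' -> C `&` sval t.2 = C' `&` sval t.2 ->
          `|linf_app t.1.2 C - linf_app t.1.2 C'| <= e / 8].
  move=> [S finS] /=.
  have [d [[Fd [w Ww wd]] nSd]] : (T `\` S) !=set0.
    by apply: infinite_setN0; exact: infinite_setD.
  have [S' finS' wS'] := closed_span_coord_tail (WX w Ww) e80.
  have fin : finite_set (S `|` [set d] `|` S').
    by rewrite !finite_setU; split=> //; split=> //; exact: finite_set1.
  exists (d, w, exist _ _ fin); split=> /=.
  - by split=> //; split=> //; exists w.
  - by [].
  - by split=> [x Sx|]; left; [left|right].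
  - move=> C C' FC FC' CC'; apply: wS' => //.
    have <- : (S `|` [set d] `|` S') `&` S' = S' by apply/setIidPr => x; right.
    by rewrite !setIA CC'.
pose S n := iter n (fun s => (hump s).2) (exist _ set0 (finite_set0 Delta)).
pose d n := (hump (S n)).1.1; pose w n := (hump (S n)).1.2.
have dT n : T (d n) by have [[]] := humpP (S n).
have dnS n : ~ sval (S n) (d n) by have [[]] := humpP (S n).
have wW n : W (w n) by have [_ []] := humpP (S n).
have wd n : e < `|linf_app (w n) [set d n]| by have [_ []] := humpP (S n).
have dS n : sval (S n.+1) (d n) by have [_ _ []] := humpP (S n).
have SS n : sval (S n) `<=` sval (S n.+1) by have [_ _ []] := humpP (S n).
have tail n C C' : Fam C -> Fam C' ->
    C `&` sval (S n.+1) = C' `&` sval (S n.+1) ->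
    `|linf_app (w n) C - linf_app (w n) C'| <= e / 8.
  by have [_ _ _] := humpP (S n); apply.
have Sle m n : (m <= n)%N -> sval (S m) `<=` sval (S n).
  elim: n => [|n IH]; first by rewrite leqn0 => /eqP ->.
  by rewrite leq_eqVlt => /predU1P[->//|/IH mn]; apply: subset_trans mn (SS n).
have dS_lt m n : (m < n)%N -> sval (S n) (d m) by move=> /Sle; apply.
have dS_ge m n : (n <= m)%N -> ~ sval (S n) (d m) by move=> /Sle nm /nm /dnS.
have d_inj : injective d.
  move=> m n mn; case: (ltngtP m n) => // [/dS_lt|/dS_lt].
    by rewrite mn => /dnS.
  by rewrite -mn => /dnS.
have [U [UU wU]] := @ultraFilterLemma _ (w @ \oo) _.
have [|v Wv vU] := cW U UU; first by apply: wU; exists 0%N => // n _; exact: wW.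
(* [d n] is added when [w n] and [v] are too close without it *)
pose G := fix G n : set Delta := if n is n.+1 then
  if `|linf_app (w n) (G n) - linf_app v (G n)| >= e / 2 then G n
  else G n `|` [set d n] else set0.
have GS n : G n `<=` G n.+1 by move=> x Gx /=; case: ifP => _ //; left.
have Gle m n : (m <= n)%N -> G m `<=` G n.
  elim: n => [|n IH]; first by rewrite leqn0 => /eqP ->.
  by rewrite leq_eqVlt => /predU1P[->//|/IH mn]; apply: subset_trans mn (GS n).
have Gd n x : G n x -> exists2 m, (m < n)%N & x = d m.
  elim: n x => [|n IH] x //= ; case: ifP => _.
    by move=> /IH[m mn ->]; exists m => //; exact: ltnW.
  by case=> [/IH[m mn ->]|->]; [exists m => //; exact: ltnW|exists n].
pose H := \bigcup_n G n.
have GF n : G n `<=` F by move=> x /Gd[m _ ->]; have [] := dT m.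
have HF : H `<=` F by move=> x [n _]; exact: GF.
have HG n x : H x -> G n x \/ exists2 m, (n <= m)%N & x = d m.
  move=> [m _ Gx]; have [mn|nm] := leqP m n; first by left; exact: Gle Gx.
  elim: m nm Gx => // m IH; rewrite ltnS leq_eqVlt => /predU1P[-> /=|nm /=].
    by case: ifP => _; [left|case=> [|->]; [left|right; exists m]].
  case: ifP => _; first exact: IH.
  by case=> [|->]; [exact: IH|right; exists m => //; exact: ltnW].
have differ n : e / 2 <= `|linf_app (w n) (G n.+1) - linf_app v (G n)|.
  rewrite /=; case: ifP => // /negbT; rewrite -ltNge => close.
  have nGd : ~ G n (d n) by move=> /Gd[m mn /d_inj nm]; rewrite nm ltnn in mn.
  rewrite closed_span_coord_add//; last 2 first.
  - exact: WX.
  - by apply: FamF => x [/GF//|->]; have [] := dT n.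
  have := wd n; move: close.
  move: (linf_app (w n) (G n)) (linf_app v (G n)) (linf_app (w n) [set d n]) =>
    a b c ab ec.
  have -> : a + c - b = c - (b - a) by ring.
  have := lerB_dist c (b - a); rewrite distrC in ab; lra.
have [Sv finSv vSv] := closed_span_coord_tail (WX v Wv) e80.
have [N SvN] : exists N, forall n, (N <= n)%N -> ~ Sv (d n).
  have : finite_set (d @^-1` Sv) by apply: finite_preimage => // x y _ _ /d_inj.
  move=> /finite_fsetP[A AE];
    exists (\max_(i <- enum_fset A) i).+1 => n Nn Svdn.
  have : [set` A] n by rewrite -AE.
  by move=> /= nA; move: Nn; rewrite ltnNge (@leq_bigmax_seq _ _ xpredT id).
have far n : (N <= n)%N -> e / 4 <= `|linf_app v H - linf_app (w n) H|.
  move=> Nn.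
  have t1 : `|linf_app (w n) H - linf_app (w n) (G n.+1)| <= e / 8.
    apply: tail; [exact: FamF|exact: FamF|].
    apply/seteqP; split=> x [] => [Hx Sx|Gx Sx]; split=> //;
      last by exists n.+1.
    by have [//|[m nm xm]] := HG n.+1 x Hx; move: Sx;
      rewrite xm => /(dS_ge _ _ nm).
  have t2 : `|linf_app v H - linf_app v (G n)| <= e / 8.
    apply: vSv; [exact: FamF|exact: FamF|].
    apply/seteqP; split=> x [] => [Hx Sx|Gx Sx]; split=> //; last by exists n.
    have [//|[m nm xm]] := HG n x Hx; move: Sx; rewrite xm => /(SvN _ _).
    by case; exact: leq_trans nm.
  have := differ n.
  move: (linf_app v H) (linf_app (w n) H) t1 t2 => a b.
  move: (linf_app (w n) (G n.+1)) (linf_app v (G n)) => a' b' t1 t2 ab.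
  have : `|a' - b'| <= `|a - b| + e / 8 + e / 8.
    have -> : a' - b' = (b - a) + (a - b') - (b - a') by ring.
    rewrite (le_trans (ler_normB _ _))// lerD// (le_trans (ler_normD _ _))//
      lerD//.
    by rewrite distrC.
  lra.
have [f fE] := linf_eval R H.
have e40 : 0 < e / 4 by rewrite divr_gt0.
have UN : U [set z | e / 4 <= `|linf_app v H - linf_app z H|].
  by apply: wU; exists N => // n /= /far.
have [z [/= zfar]] := filter_ex (filterI UN (vU f _ e40)).
by rewrite /= !fE ltNge zfar.
Qed.

End hereditary_family.

(** * Construction of the spaces *)

Lemma greedy_sequence (T : Type) (P : set T -> T -> Prop) :
  (forall D, finite_set D -> exists x, P D x) ->
  exists x : nat -> T, forall n, exists2 D : set T,
    (forall m, (m < n)%N -> D (x m)) & P D (x n).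
Proof.
move=> PD.
have /choice[h hP] :
    forall D : {D : set T | finite_set D}, exists x, P (sval D) x.
  by move=> [D finD]; exact: PD.
have fin (D : {D : set T | finite_set D}) x : finite_set (sval D `|` [set x]).
  by rewrite finite_setU; split; [exact: svalP D|exact: finite_set1].
pose D n :=
  iter n (fun D => exist _ _ (fin D (h D))) (exist _ set0 (finite_set0 T)).
exists (h \o D) => n; exists (sval (D n)); last exact: hP.
elim: n => // n IH m; rewrite ltnS leq_eqVlt => /predU1P[->|/IH Dm];
  first by right.
by left.
Qed.

Section example.
Variables (R : realType) (kappa tau Gamma : Type).
Hypotheses (kappa_inf : infinite_set [set: kappa]).
Hypotheses (tau_inf : infinite_set [set: tau]).
Hypotheses (Gamma_inf : infinite_set [set: Gamma]).
Variables (phi : Gamma -> seq_space kappa) (grp : Gamma -> tau).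

Definition node : Type := ((nat * Gamma) + kappa)%type.

(** The families of points on which the norm is an [l_1]-norm: at level [n], the
    sets of [g] on which both the [n]-th term of [phi g] and [grp g] are
    injective; on [kappa], all sets. *)
Definition admissible (C : set node) : Prop :=
  (exists n, (forall c, C c -> exists g, c = inl (n, g)) /\
     forall g g', C (inl (n, g)) -> C (inl (n, g')) ->
       phi g n = phi g' n \/ grp g = grp g' -> g = g') \/
  (forall c, C c -> exists k, c = inr k).

Lemma admissible_sub (C C' : set node) :
  C' `<=` C -> admissible C -> admissible C'.
Proof.
move=> sub [[n [Cn Cinj]]|Ck]; [left; exists n; split|right] => //.
- by move=> c /sub; exact: Cn.
- by move=> g g' /sub Cg /sub; exact: Cinj.
- by move=> c /sub; exact: Ck.
Qed.

Lemma admissible_level (C : set node) n m g g' :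
  admissible C -> C (inl (n, g)) -> C (inl (m, g')) -> n = m.
Proof.
move=> [[l [Cl _]]|Ck] Cn Cm; last by have [] := Ck _ Cn.
by have [_ [-> _]] := Cl _ Cn; have [_ [-> _]] := Cl _ Cm.
Qed.

Lemma admissible_inj (C : set node) n g g' :
  admissible C -> C (inl (n, g)) -> C (inl (n, g')) ->
  phi g n = phi g' n \/ grp g = grp g' -> g = g'.
Proof.
move=> [[l [Cl Cinj]]|Ck] Cg Cg'; last by have [] := Ck _ Cg.
by have [_ [ln _]] := Cl _ Cg; move: Cg Cg'; rewrite ln; exact: Cinj.
Qed.

Lemma admissible1 c : admissible [set c].
Proof.
case: c => [[n g]|k]; [left; exists n; split|right].
- by move=> _ ->; exists g.
- by move=> g1 g2 [->] [->].
- by move=> _ ->; exists k.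
Qed.

Local Notation B := (linf R (set node)).
Local Notation e := (coord R admissible).
Local Notation X := (csub_type (closed_span e)).

Let q (n : nat) : R := 2^-1 ^+ n.

Let q_gt0 n : 0 < q n. Proof. by rewrite exprn_gt0// invr_gt0. Qed.

Let q_le1 n : q n <= 1.
Proof. by rewrite exprn_ile1 ?invr_ge0// invf_le1// ler1n. Qed.

(** The values of [sum_n 2^-n e_(n, g)]: an admissible set meets at most one
    level. *)
Let y_fun g (C : set node) : R :=
  if pselect (admissible C /\ exists n, C (inl (n, g))) is left h
  then q (sval (cid h.2)) else 0.

Let y_fun_le g C : `|y_fun g C| <= 1.
Proof.
rewrite /y_fun; case: pselect => [h|_]; last by rewrite normr0.
by rewrite gtr0_norm.
Qed.

Let y g : B := sval (cid (linf_of (y_fun_le g))).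

Let yE g C : linf_app (y g) C = y_fun g C.
Proof. by rewrite /y; case: cid => u /= ->. Qed.

Let y_in g C n : admissible C -> C (inl (n, g)) -> linf_app (y g) C = q n.
Proof.
move=> aC Cn; rewrite yE /y_fun; case: pselect => [h|[]]; last first.
  by split=> //; exists n.
by case: cid => m /= Cm; rewrite (admissible_level aC Cm Cn).
Qed.

Let y_out g C :
  ~ (admissible C /\ exists n, C (inl (n, g))) -> linf_app (y g) C = 0.
Proof. by move=> nC; rewrite yE /y_fun; case: pselect. Qed.

Let y_supp g C :
  linf_app (y g) C != 0 -> admissible C /\ exists n, C (inl (n, g)).
Proof. by move=> yC; apply: contrapT => /y_out yC0; rewrite yC0 eqxx in yC. Qed.

Let y_partial g N : exists2 p, lspan e p &
  forall C, linf_app p C =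
    if `[< admissible C /\ exists2 n, (n < N)%N & C (inl (n, g)) >]
    then linf_app (y g) C else 0.
Proof.
elim: N => [|N [p lp pE]].
  exists 0 => [|C]; first by case: (lspan_linear e).
  by rewrite asboolF// => -[_ []].
exists (q N *: e (inl (N, g)) + p) => [|C].
  by have [_ SD] := lspan_linear e; apply: SD => //; exact: lspan_gen.
rewrite linf_axpy pE; have [aC|naC] := pselect (admissible C); last first.
  by rewrite coord_out// mulr0 add0r !asboolF// => -[].
rewrite coordE//; case: (asboolP (C _)) => CN.
  rewrite mulr1 asboolF ?addr0; last first.
    by move=> [_ [n nN Cn]]; move: nN; rewrite (admissible_level aC Cn CN) ltnn.
  rewrite asboolT; first by rewrite (y_in aC CN).
  by split=> //; exists N.
rewrite mulr0 add0r; congr (if _ then _ else _); apply: asbool_equiv_eq.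
split=> -[_ [n nN Cn]]; split=> //; exists n => //; first exact: ltnW.
move: nN; rewrite ltnS leq_eqVlt => /predU1P[nN|//].
by case: CN; rewrite -nN.
Qed.

Let y_closed_span g : closed_span_set e (y g).
Proof.
move=> d d0.
have [N Nd] : exists N, q N < d.
  have dN : 0 <= d^-1 by rewrite invr_ge0 ltW.
  exists (Num.bound d^-1); rewrite /q exprVn invf_plt ?posrE ?exprn_gt0//.
  apply: lt_le_trans (archi_boundP dN) _.
  by rewrite -natrX ler_nat ltnW// ltn_expl.
have [p lp pE] := y_partial g N; exists p => //.
apply: le_lt_trans Nd; apply: linf_norm_leP => [|C]; first exact: ltW.
have -> : linf_app (y g - p) C = linf_app (y g) C - linf_app p C by [].
rewrite pE; case: asboolP => h; first by rewrite subrr normr0 ltW.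
rewrite subr0; have [->|yC] := eqVneq (linf_app (y g) C) 0.
  by rewrite normr0 ltW.
have [aC [n Cn]] := y_supp yC; rewrite (y_in aC Cn) gtr0_norm//.
have Nn : (N <= n)%N.
  by rewrite leqNgt; apply/negP => nN; apply: h; split=> //; exists n.
by rewrite /q -(subnK Nn) exprD ler_piMl ?exprn_ge0 ?invr_ge0// q_le1.
Qed.

Let lift_X (u : B) (ux : closed_span_set e u) : X :=
  exist _ u (mem_set ux).

Let eX c : X := lift_X (@closed_span_gen _ _ _ e c).
Let yX g : X := lift_X (y_closed_span g).

Local Notation Y0 := (closed_span yX).
Local Notation Y := (csub_type Y0).

Let yY g : Y := exist _ (yX g) (mem_set (@closed_span_gen _ _ _ yX g)).

Let TX : {linear X -> B} := [the {linear X -> B} of val].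
Let TY : {linear Y -> B} :=
  [the {linear Y -> B} of (val : X -> B) \o (val : Y -> X)].

Let TX_iso x : `|TX x| = `|x|. Proof. by []. Qed.
Let TY_iso x : `|TY x| = `|x|. Proof. by []. Qed.

Let TY_span x : closed_span_set e (TY x).
Proof. exact: set_mem (valP (val x)). Qed.

Let coord_le c C : `|linf_app (e c) C| <= 1.
Proof.
have [aC|naC] := pselect (admissible C); last by rewrite coord_out// normr0.
by rewrite coordE//; case: asboolP; rewrite ?normr1 ?normr0.
Qed.

Let coord_supp c C : linf_app (e c) C != 0 -> admissible C /\ C c.
Proof.
have [aC|naC] := pselect (admissible C); last by rewrite coord_out// eqxx.
by rewrite coordE//; case: asboolP => // _; rewrite eqxx.
Qed.

(** The unit vectors at level [n] for which [phi g n] is a given [k] have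
    disjoint supports: an admissible set contains at most one of these [g]. *)
Lemma CG_X_le : exists K : kappa -> set (weak X),
  (forall k, compact (K k)) /\ dense (\bigcup_k K k).
Proof.
pose P (i : (nat * kappa) + kappa) : set node := match i with
  | inl (n, k) => [set c | exists2 g, c = inl (n, g) & phi g n = k]
  | inr k => [set inr k] end.
apply: (@CG_generated _ X _ _ (fun i => [set 0] `|` eX @` P i)) => //.
- apply: (@card_le_trans _ (bool * (nat * kappa))%type _ setT).
    apply/card_leTP.
    exists (fun i => match i with
      | inl u => (true, u) | inr k => (false, (0%N, k)) end).
    by move=> [u|k] [u'|k'] // [->].
  apply: card_prod_le => //.
    by apply: card_le_trans ((infiniteP _).1 kappa_inf); exact: countableP.
  by apply: card_prod_le => //; apply/infiniteP.
- move=> i; apply: (@disjoint_family_compact _ _ X TX) => // c c' C Pc Pc'.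
  move=> /coord_supp[aC Cc] /coord_supp[_ Cc'].
  case: i Pc Pc' => [[n k]|k] /=; last by move=> -> ->.
  move=> [g cE gk] [g' c'E g'k]; rewrite cE c'E in Cc Cc' *; congr (inl (_, _)).
  by apply: (admissible_inj aC Cc Cc'); left; rewrite gk g'k.
- move=> S Slin KS; apply: closed_span_dense => // x [c xc].
  have -> : x = eX c by apply: val_inj.
  case: c {xc} => [[n g]|k]; apply: KS.
    by exists (inl (n, phi g n)) => //; right; exists (inl (n, g)) => //;
      exists g.
  by exists (inr k) => //; right; exists (inr k).
Qed.

Let lower_points (Z : normedModType R) (T : {linear Z -> B}) (L : Type)
    (K : L -> set (weak Z)) (z : Z) (C : set node) :
      (forall x, `|T x| = `|x|) ->
  dense (\bigcup_l K l) -> linf_app (T z) C = 1 ->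
  exists l, exists2 x : Z, K l x & 2^-1 < `|linf_app (T x) C|.
Proof.
move=> Tiso dK zC; have [f fE] := isometry_eval Tiso C.
have h0 : 0 < 2^-1 :> R by rewrite invr_gt0.
have [x [l _ Kx] zx] := weak_dense_near f z h0 dK.
exists l, x => //; move: zx; rewrite !fE zC => zx.
have := lerB_dist 1 (1 - linf_app (T x) C).
rewrite normr1 subKr; lra.
Qed.

(** The unit vectors indexed by [kappa] span a copy of [l_1]: a weakly compact
    set accounts for finitely many of them. *)
Lemma CG_X_ge (L : Type) (K : L -> set (weak X)) : infinite_set [set: L] ->
  (forall l, compact (K l)) -> dense (\bigcup_l K l) ->
  [set: kappa] #<= [set: L].
Proof.
move=> Linf cK dK.
apply: (@card_le_countable_cover _ L _
  (fun l =>
    [set k | exists2 x, K l x & 2^-1 < `|linf_app (TX x) [set inr k]|])) => //.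
  move=> l; apply: finite_set_countable.
  have h0 : 0 < 2^-1 :> R by rewrite invr_gt0.
  have cTK := weak_compact_image (isometry_continuous TX_iso) (cK l).
  have := weak_compact_coords admissible_sub cTK _ (F := range inr) _ h0.
  move=> /(_ _ _)/(finite_preimage (f := inr)) fin.
  apply: sub_finite_set (fin _ _ _) => [k [x Kx kx]|k k' _ _ [] //| |].
  - by split; [exists k|exists (TX x) => //; exists x].
  - by move=> _ [x _ <-]; exact: set_mem (valP x).
  - by right=> c [k _ <-]; exists k.
move=> k; apply: (@lower_points X TX _ _ (eX (inr k))) => //.
by rewrite coordE ?asboolT//; exact: admissible1.
Qed.

(** An admissible set contains at most one [g] in each class of [grp], hence the
    vectors [yY g] in a class have disjoint supports. *)
Lemma CG_Y_le : exists K : tau -> set (weak Y),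
  (forall i, compact (K i)) /\ dense (\bigcup_i K i).
Proof.
apply: (@CG_generated _ Y tau tau
  (fun i => [set 0] `|` yY @` [set g | grp g = i])) => //.
- move=> i; apply: (@disjoint_family_compact _ _ Y TY) => //.
    by move=> g C; rewrite [linf_app _ _]yE y_fun_le.
  move=> g g' C gi g'i /y_supp[aC [n Cn]] /y_supp[_ [m Cm]].
  move: (Cm); rewrite -(admissible_level aC Cn Cm) => {}Cm.
  by apply: (admissible_inj aC Cn Cm); right; rewrite gi g'i.
- move=> S Slin KS; apply: closed_span_dense => // x [g xg].
  have -> : x = yY g by apply: val_inj.
  by apply: KS; exists (grp g) => //; right; exists g.
Qed.

Let TY_level (x : Y) n g :
  linf_app (TY x) [set inl (n, g)] = q n * linf_app (TY x) [set inl (0%N, g)].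
Proof.
pose h (u : X) : R :=
  linf_app (TX u) [set inl (n, g)] - q n * linf_app (TX u) [set inl (0%N, g)].
apply/eqP; rewrite -subr_eq0; apply/eqP.
apply: (@closed_span_vanish R X _ yX h 2) (set_mem (valP x)) => [a u v|u|g'].
- rewrite /h (_ : TX (a *: u + v) = a *: TX u + TX v); last exact: linearP.
  by rewrite !linf_axpy; ring.
- rewrite /h (le_trans (ler_normB _ _))// normrM gtr0_norm//.
  have l1 := linf_app_norm (TX u) [set inl (n, g)].
  have l2 := linf_app_norm (TX u) [set inl (0%N, g)].
  have l3 : q n * `|linf_app (TX u) [set inl (0%N, g)]| <= `|TX u|.
    by rewrite (le_trans _ l2)// ler_piMl.
  by rewrite mulr_natl mulr2n lerD.
- rewrite -[h _]/(linf_app (y g') [set inl (n, g)] -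
                  q n * linf_app (y g') [set inl (0%N, g)]).
  have [<-|gg'] := pselect (g = g').
    rewrite (y_in (n := n))//; last exact: admissible1.
    by rewrite (y_in (n := 0%N)) ?mulr1 ?subrr//; exact: admissible1.
  have out k : linf_app (y g') [set inl (k, g)] = 0.
    by apply: y_out => -[_ [m [_ g'g]]]; exact: gg'.
  by rewrite !out mulr0 subrr.
Qed.

(** Let [S l] be the set of [g] whose coordinate exceeds [2^-1] on [K l]. Fewer
    than [tau] sets [S l] cannot cover the copy of [A] in the class [i] by sets
    with compact closure, so some [S l] contains points of this class for which
    [phi g n] takes infinitely many values. As [l] and [n] vary among fewer than
    [tau] pairs, infinitely many classes share them. Picking one point in each
    of these classes, with distinct values [phi g n], gives an infinite
    admissible set at level [n] included in [S l], against the weak compactness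
    of [K l]. *)
Lemma CG_Y_ge (A : set (seq_space kappa)) :
  not_covered_by_fewer tau A ->
  (forall x i, A x -> exists g, phi g = x /\ grp g = i) ->
  forall (L : Type) (K : L -> set (weak Y)), infinite_set [set: L] ->
  (forall l, compact (K l)) -> dense (\bigcup_l K l) ->
  [set: tau] #<= [set: L].
Proof.
move=> Abig Aphi L K Linf cK dK; apply: contrapT => tauL.
have Ltau : [set: L] #<= [set: tau] by have [] := card_le_total L tau.
pose S l : set Gamma :=
  [set g | exists2 x, K l x & 2^-1 < `|linf_app (TY x) [set inl (0%N, g)]|].
have Scover g : exists l, S l g.
  apply: (@lower_points Y TY _ _ (yY g)) => //.
  rewrite -[linf_app _ _]/(linf_app (y g) [set inl (0%N, g)]).
  by rewrite (y_in (n := 0%N))//; exact: admissible1.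
have /choice[h hP] : forall i : tau, exists ln : L * nat,
    infinite_set [set phi g ln.2 | g in [set g | S ln.1 g /\ grp g = i]].
  move=> i; apply: contrapT => /forallNP fin.
  apply: (Abig L (fun l => [set x | forall n,
      [set phi g n | g in [set g | S l g /\ grp g = i]] (x n)])) => //.
    move=> l; apply: (@seq_space_compact_box kappa
      (fun n => [set phi g n | g in [set g | S l g /\ grp g = i]])) => n.
    exact: contrapT (fin (l, n)).
  move=> x Ax; have [g [gx gi]] := Aphi x i Ax; have [l Sl] := Scover g.
  by exists l => // n; exists g; rewrite ?gx.
have [[l n] Qinf] : exists ln, infinite_set [set i | h i = ln].
  apply: contrapT => /forallNP fin; apply: tauL.
  apply: (@card_le_countable_cover L (L * nat) _ (fun ln =>
    [set i | h i = ln])) => //.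
  - by apply: card_prod_le => //; apply/infiniteP.
  - by move=> ln; apply: finite_set_countable; exact: contrapT (fin ln).
  - by move=> i; exists (h i).
have [|x xP] := @greedy_sequence Gamma (fun D g => [/\ S l g,
    forall g', D g' -> grp g <> grp g' &
    forall g', D g' -> phi g n <> phi g' n]).
  move=> D finD.
  have [i [hi nDi]] : ([set i | h i = (l, n)] `\` grp @` D) !=set0.
    by apply: infinite_setN0; apply: infinite_setD => //; exact: finite_image.
  have := hP i; rewrite hi /= => inf.
  have [_ [[g [Sg gi] <-] nDg]] :
      ([set phi g n | g in [set g | S l g /\ grp g = i]]
        `\` (phi^~ n) @` D) !=set0.
    by apply: infinite_setN0; apply: infinite_setD => //; exact: finite_image.
  exists g; split=> // g' Dg' gg'; [apply: nDi|apply: nDg]; exists g' => //.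
  by rewrite -gg'.
have xlt m m' : (m < m')%N ->
  grp (x m) <> grp (x m') /\ phi (x m) n <> phi (x m') n.
  move=> mm'; have [D xD [_ /(_ _ (xD _ mm')) gD /(_ _ (xD _ mm')) pD]]
    := xP m'.
  by split=> E; [apply: gD|apply: pD].
have xinj m m' : phi (x m) n = phi (x m') n \/ grp (x m) = grp (x m') -> m = m'.
  by move=> H; case: (ltngtP m m') => // /xlt[n1 n2]; case: H => E; exfalso;
    auto.
pose F : set node := range (fun m => inl (n, x m)).
have aF : admissible F.
  left; exists n; split=> [_ [m _ <-]|g g' [m _ [<-]] [m' _ [<-]] /xinj -> //].
  by exists (x m).
have e0 : 0 < q n * 2^-1 by rewrite mulr_gt0// invr_gt0.
have cTK := weak_compact_image (isometry_continuous TY_iso) (cK l).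
have TKspan : TY @` K l `<=` closed_span_set e by move=> _ [z _ <-];
  exact: TY_span.
have := weak_compact_coords admissible_sub cTK TKspan aF e0.
suff Finf : infinite_set F.
  apply: contra_not Finf; apply: sub_finite_set => _ [m _ <-]; split;
    first by exists m.
  have [D _ [[z Kz zx] _ _]] := xP m; exists (TY z); first by exists z.
  by rewrite TY_level normrM gtr0_norm// ltr_pM2l.
have Fnat : F #= [set: nat].
  by apply: inj_card_eq => m m' _ _ [E]; apply: xinj; left; rewrite E.
by rewrite (eq_finite_set Fnat); exact: infinite_nat.
Qed.

Lemma dens_Y : is_dens Y Gamma.
Proof.
apply: (@separated_is_dens R Y Gamma yY) => // [|g g' gg'].
  apply: closed_span_dense => [|x [g xg]]; first exact: lspan_linear.
  have -> : x = yY g by apply: val_inj.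
  exact: lspan_gen.
rewrite -TY_iso; apply: le_trans (linf_app_norm _ [set inl (0%N, g)]).
have -> : linf_app (TY (yY g - yY g')) [set inl (0%N, g)] =
  linf_app (y g) [set inl (0%N, g)] - linf_app (y g') [set inl (0%N, g)] by [].
rewrite (y_in (n := 0%N))//; last exact: admissible1.
rewrite y_out ?subr0 ?normr1// => -[_ [m [_ g'g]]]; exact: gg'.
Qed.

Lemma CG_example (A : set (seq_space kappa)) :
  not_covered_by_fewer tau A ->
  (forall x i, A x -> exists g, phi g = x /\ grp g = i) ->
  exists (X : completeNormedModType R) (Y : closed_subspace X),
     [/\ is_CG (weak X) kappa, is_CG (weak (csub_type Y)) tau &
         is_dens (csub_type Y) Gamma].
Proof.
move=> Abig Aphi; exists X, Y0; split; last exact: dens_Y.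
- split; first by split=> //; exact: CG_X_le.
  by move=> L [Linf [K [cK dK]]]; exact: CG_X_ge cK dK.
- split; first by split=> //; exact: CG_Y_le.
  by move=> L [Linf [K [cK dK]]]; exact: (CG_Y_ge Abig Aphi) cK dK.
Qed.

End example.

(** The singletons show that [A] has at least [tau] points, so that [A * tau]
    has the cardinality of [A] and is an image of [delta]. *)
Lemma b_surjection (kappa tau delta : Type) :
  infinite_set [set: tau] -> infinite_set [set: delta] ->
  (exists b, is_b kappa tau b /\ [set: b] #<= [set: delta]) ->
  exists (A : set (seq_space kappa)) (phi : delta -> seq_space kappa)
         (grp : delta -> tau),
    not_covered_by_fewer tau A /\
    forall x i, A x -> exists g, phi g = x /\ grp g = i.
Proof.
move=> tau_inf delta_inf [b [[[A [Ab Abig]] _] bdelta]].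
have Adelta : [set: A] #<= [set: delta].
  by rewrite (card_le_eql (card_setT A)) (card_le_eql Ab).
have tauA : [set: tau] #<= [set: A].
  apply: contrapT => tauA.
  have Atau : [set: A] #<= [set: tau] by have [] := card_le_total A tau.
  apply: (Abig A (fun x => [set val x]) Atau tauA) => [x|x Ax].
    exact: compact_set1.
  by exists (SigSub (mem_set Ax)).
have /card_leTP[j j_inj] : [set: A * tau] #<= [set: delta].
  by apply: card_prod_le => //; exact: card_le_trans Adelta.
have [i0 _] := infinite_setN0 tau_inf.
have [a0 _] : [set: A] !=set0.
  have /card_leTP[f _] := tauA; by exists (f i0).
have /choice[r rP] :
    forall g : delta, exists u : A * tau, forall v, j v = g -> u = v.
  move=> g; have [[v vg]|no] := pselect (exists v, j v = g).
    by exists v => v' v'g; apply: j_inj; rewrite vg.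
  by exists (a0, i0) => v vg; case: no; exists v.
exists A, (fun g => val (r g).1), (fun g => (r g).2); split=> // x i Ax.
exists (j (SigSub (mem_set Ax), i)).
by rewrite (rP _ _ erefl).
Qed.

Theorem theorem3 (R : realType) (kappa tau delta : Type)
    (kappa_infinite : infinite_set [set: kappa])
    (tau_infinite : infinite_set [set: tau])
    (delta_infinite : infinite_set [set: delta]) :
  ((exists d, is_d kappa d /\ [set: tau] #<= [set: d]) /\
   (exists b, is_b kappa tau b /\ [set: b] #<= [set: delta]))
  <->
  (exists (X : completeNormedModType R) (Y : closed_subspace X),
     [/\ is_CG (weak X) kappa,
         is_CG (weak (csub_type Y)) tau &
         is_dens (csub_type Y) delta]).
Proof.
split=> [[_ bdelta]|[X [Y [CGX CGY densY]]]];
  last exact: CG_subspace_bounds CGX CGY densY.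
have [A [phi [grp [Abig Aphi]]]]
  := b_surjection tau_infinite delta_infinite bdelta.
exact: CG_example Aphi.
Qed.
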